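(* Let $d\ge1$ be an integer, let the job size distribution have mean $\mathbb{E}[G]$, let $0<\rho=\lambda\,\mathbb{E}[G]<1$, and let $\pi_0\in(0,1]$ be the equilibrium probability that the dispatcher's memory is empty. Let $R$ be the response time of the memory dependent LL($d$) policy with this job size distribution and arrival rate $\lambda$. Let $\tilde R$ be the response time for the same system without memory, but with arrival rate $\lambda\pi_0^{1/d}$. Then $R$ and $\tilde R$ have the same distribution.
   Context: Job sizes have a general distribution $G$ on $(0,\infty)$ with probability density function $g$ and complementary cdf $\bar G$. Queue at the cavity for LL($d$) (join the least loaded of $d$ queues) with memory, arrival rate $\lambda$, empty-memory probability $\pi_0$, in equilibrium: its state is its workload $W\ge0$ (amount of unfinished work), which decreases linearly at rate $1$ while positive and jumps up by the size of each job that joins. The equilibrium law of $W$ has an atom at $0$ and a density $f$ on $(0,\infty)$; $\bar F(w)=\mathbb{P}(W>w)$. - Potential arrivals occur at rate $\lambda d\pi_0$. At a potential arrival, $d-1$ i.i.d. workloads with the equilibrium law of $W$ are drawn, independent of $W$; the job joins the queue at the cavity iff its workload is the smallest of the $d$ values, ties being broken uniformly at random. - When $W=0$ there is an additional arrival rate $\lambda(1-\pi_0)/(1-\bar F(0))$ (jobs routed to an idle server whose id is in memory). - Job sizes are i.i.d. with density $g$. The equilibrium is a probability law that is stationary for this process with rates computed from that same law. Response time $R$ of an arriving job: with probability $1-\pi_0$ the job is sent to an idle server and its response time is its own size; with probability $\pi_0$ its response time is the minimum of $d$ independent workloads with the equilibrium law of $W$, plus its own independent size. The system without memory with arrival rate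 $\lambda'$ is the same model with $\lambda$ replaced by $\lambda'$ and $\pi_0$ replaced by $1$. *)

(* Defs.v *)
From mathcomp Require Import all_boot all_order all_algebra.
From mathcomp Require Import all_classical all_reals all_analysis.
Import Order.TTheory GRing.Theory Num.Theory.
Import numFieldNormedType.Exports.

Set Implicit Arguments.
Unset Strict Implicit.
Unset Printing Implicit Defensive.

Local Open Scope classical_set_scope.
Local Open Scope ring_scope.

(* A probability law on the Borel sets of the real line. *)
Notation law R := (probability (measurableTypeR R) R).

Section cavity_queue.
Context {R : realType}.

(* Only the part of [m] carried by (0, +oo) is constrained. *)
Definition density_on_pos (m : law R) (f : R -> R) : Prop :=
  [/\ measurable_fun (`]0, +oo[ : set (measurableTypeR R)) f,
      (forall x, 0 < x -> 0 <= f x) &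
      forall A : set (measurableTypeR R), measurable A -> A `<=` `]0, +oo[%classic ->
        m A = (\int[lebesgue_measure]_(x in A) (f x)%:E)%E].

Definition job_size_law (G : law R) (g : R -> R) : Prop :=
  G `]0, +oo[%classic = 1%E /\ density_on_pos G g.

Definition ccdf (m : law R) (w : R) : R := fine (m `]w, +oo[%classic).

(* E[h [:: U_1; ...; U_n]] for U_1, ..., U_n i.i.d. with law m, written as an
   iterated integral. *)
Fixpoint iid_expectation (m : law R) (n : nat) (h : seq R -> \bar R) : \bar R :=
  if n is n'.+1 then
    (\int[m]_u iid_expectation m n' (fun us => h (u :: us)))%E
  else h [::].

(* Probability that a queue with workload w wins against queues with workloads
   us: it has to be minimal, and then it is chosen uniformly among itself and
   the queues of us tied with it. *)
Definition win_prob (w : R) (us : seq R) : R :=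
  if all (fun u => w <= u) us then (count_mem w us).+1%:R^-1 else 0.

(* [env] is the law of the workloads of the other queues, from which the rates
   are computed. *)
Section dynamics.
Variables (d : nat) (G : law R) (lambda pi0 : R) (env : law R).

Definition potential_rate : R := lambda * d%:R * pi0.

Definition memory_rate (w : R) : R :=
  if w == 0 then lambda * (1 - pi0) / (1 - ccdf env 0) else 0.

Definition drain (s w : R) : R := Num.max (w - s) 0.

(* Probability that a queue started at w sees no potential arrival and no
   arrival from the memory during [0, s]; without arrivals, it is empty for
   a time (s - w)^+ in this interval. *)
Definition no_arrival (s w : R) : R :=
  expR (- (potential_rate * s + memory_rate 0 * Num.max (s - w) 0)).

(* E[h(W)] right after a job joined a queue with workload w. *)
Definition after_join (h : R -> \bar R) (w : R) : \bar R :=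
  (\int[G]_x h (w + x)%R)%E.

(* E[h(W)] right after a potential arrival at a queue with workload w. *)
Definition after_potential (h : R -> \bar R) (w : R) : \bar R :=
  iid_expectation env d.-1 (fun us =>
    (win_prob w us)%:E * after_join h w + (1 - win_prob w us)%:E * h w)%E.

(* P(W(t) \in A and at most n potential or memory arrivals occur in [0, t] |
   W(0) = w), by conditioning on the time s of the first one. *)
Fixpoint transition_upto (n : nat) (A : set R) (t w : R) : \bar R :=
  ((no_arrival t w)%:E * (\1_A (drain t w))%:E +
   if n is n'.+1 then
     \int[lebesgue_measure]_(s in `[0%R, t])
       ((no_arrival s w)%:E *
        (potential_rate%:E *
           after_potential (transition_upto n' A (t - s)) (drain s w) +
         (memory_rate (drain s w))%:E *
           after_join (transition_upto n' A (t - s)) (drain s w)))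
   else 0)%E.

(* P(W(t) \in A | W(0) = w) *)
Definition transition (A : set R) (t w : R) : \bar R :=
  ereal_sup (range (fun n => transition_upto n A t w)).

Definition stationary (mu : law R) : Prop :=
  forall (t : R) (A : set (measurableTypeR R)), 0 <= t -> measurable A ->
    (\int[mu]_w transition A t w)%E = mu A.

End dynamics.

Definition equilibrium (d : nat) (G : law R) (lambda pi0 : R) (mu : law R) :
    Prop :=
  [/\ mu `]-oo, 0[%classic = 0%E, (0 < mu [set 0%R])%E,
      (exists f : R -> R, density_on_pos mu f) &
      stationary d G lambda pi0 mu mu].

Definition min_load (ws : seq R) : R :=
  \big[Num.min/head 0 ws]_(w <- ws) w.

(* The law A |-> P(R \in A) of the response time R. *)
Definition response_law (d : nat) (G : law R) (pi0 : R) (mu : law R)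
    (A : set R) : \bar R :=
  ((1 - pi0)%:E * G A +
   pi0%:E * iid_expectation mu d (fun ws =>
     G [set x | A (min_load ws + x)%R]))%E.

End cavity_queue.

(* Main.v *)
(** Write u(w) = P(W > w), H for the ccdf of the job sizes and
    x(w) = pi0 * u(w)^d. Stationarity gives the level-crossing equation
      u(0) - u(w) = lambda * \int_0^w H(s) (1 - x(w - s)) ds,
    so h = pi0^(1/d) * u solves
      h(0) - h(w) = lambda * pi0^(1/d) * \int_0^w H(s) (1 - h(w - s)^d) ds,
    which is the equation of the system without memory and arrival rate
    lambda * pi0^(1/d). Both solutions tend to 0 at infinity, so they have the
    same initial value, and then they agree by Gronwall's inequality. Hence
    pi0 * P(min > w) is the same for both systems (min being the minimum of d
    workloads), and the response time is an independent job size added to a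
    variable that is 0 with probability 1 - pi0 and min otherwise.

    Integrals in w are replaced by sums over a grid of mesh t, with errors O(t).
    On the grid, the equation follows from lower bounds on the transition
    probabilities alone, counting at most one arrival during [0, t]: bounding
    P(W(t) > w) and P(W(t) <= w) from below bounds both from above, too. *)
Require Import Defs.
From HB Require Import structures.
From mathcomp Require Import all_boot all_order all_algebra.
From mathcomp Require Import all_classical all_reals all_analysis.
From mathcomp Require Import measurable_realfun ring lra.
Import Order.TTheory GRing.Theory Num.Theory.
Import numFieldNormedType.Exports.
Local Open Scope classical_set_scope.
Local Open Scope ring_scope.

Set Implicit Arguments.
Unset Strict Implicit.
Unset Printing Implicit Defensive.

(* [all_analysis] shadows [ccdf] with the ccdf of a random variable. *)
Local Notation ccdf := Defs.ccdf.

(** * Integrals bounded below by step functions *)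

Section integral_lower_bounds.
Import HBNNSimple.

(** The integral of a nonnegative function is a supremum over the simple functions below it, hence
    monotone for arbitrary nonnegative functions. This applies to transition probabilities, whose
    measurability is not established. *)
Lemma ge0_le_integral_nonmeasurable d (T : measurableType d) (R : realType)
    (m : {measure set T -> \bar R}) (D : set T) (f1 f2 : T -> \bar R) :
  (forall x, D x -> 0 <= f1 x)%E -> (forall x, D x -> f1 x <= f2 x)%E ->
  (\int[m]_(x in D) f1 x <= \int[m]_(x in D) f2 x)%E.
Proof.
move=> f10 f12.
have f20 x : D x -> (0 <= f2 x)%E by move=> Dx; apply: le_trans (f10 _ Dx) (f12 _ Dx).
rewrite !ge0_integralE//; apply: ereal_sup_le => _ [h /= hf <-].
exists h => //= x; apply: le_trans (hf x) _.
by rewrite /patch; case: ifPn => //; rewrite inE => /f12.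
Qed.

Lemma integral_ge_sum_indic d (T : measurableType d) (R : realType)
    (m : {measure set T -> \bar R}) (D : set T) (f : T -> \bar R) (n : nat)
    (c : nat -> R) (B : nat -> set T) :
  measurable D ->
  (forall i, (i < n)%N -> 0 <= c i) ->
  (forall i, (i < n)%N -> measurable (B i)) ->
  (forall x, D x -> (\sum_(i < n) c i * \1_(B i) x)%:E <= f x)%E ->
  (\sum_(i < n) (c i)%:E * m (B i `&` D) <= \int[m]_(x in D) f x)%E.
Proof.
move=> mD c0 mB cf.
apply: (@le_trans _ _ (\int[m]_(x in D) (\sum_(i < n) (c i)%:E * (\1_(B i) x)%:E)))%E.
  rewrite ge0_integral_sum//; last 2 first.
  - move=> i; apply: measurable_funeM; apply/measurable_EFinP.
    exact: measurable_indic (mB i (ltn_ord i)).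
  - by move=> i x _; rewrite mule_ge0// lee_fin// c0.
  apply: lee_sum => i _.
  rewrite ge0_integralZl ?lee_fin ?c0//; first by rewrite integral_indic//; apply: mB.
  by apply/measurable_EFinP; apply: measurable_indic; apply: mB.
apply: ge0_le_integral_nonmeasurable => x Dx.
  by apply: sume_ge0 => i _; rewrite mule_ge0// lee_fin// c0.
apply: le_trans (cf x Dx).
by rewrite -sumEFin; apply: lee_sum => i _; rewrite EFinM.
Qed.

End integral_lower_bounds.

(** * Complementary cdfs and integration over a grid *)

Section law_lemmas.
Context {R : realType}.
Implicit Types (mu : law R).

Lemma ccdfE mu w : mu `]w, +oo[%classic = (ccdf mu w)%:E.
Proof. by rewrite /ccdf fineK// fin_num_measure. Qed.

Lemma ccdf_ge0 mu w : 0 <= ccdf mu w.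
Proof. by rewrite -lee_fin -ccdfE. Qed.

Lemma ccdf_le1 mu w : ccdf mu w <= 1.
Proof. by rewrite -lee_fin -ccdfE probability_le1. Qed.

Lemma ccdf_itvNyc mu w : mu `]-oo, w]%classic = (1 - ccdf mu w)%:E.
Proof.
by rewrite EFinB -ccdfE -setCitvr probability_setC// ccdfE.
Qed.

Lemma ccdf_itvoc mu a b : a <= b ->
  mu `]a, b]%classic = (ccdf mu a - ccdf mu b)%:E.
Proof.
move=> ab.
have -> : `]a, b]%classic = (`]a, +oo[ `\` `]b, +oo[ : set R).
  by rewrite eqEsubset; split => x /=; rewrite !in_itv/= !andbT; lra.
rewrite measureD//; last by rewrite -ge0_fin_numE// fin_num_measure.
rewrite setIidr; last by move=> x /=; rewrite !in_itv/= !andbT; lra.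
by rewrite EFinB -!ccdfE.
Qed.

Lemma ccdf_nincr mu a b : a <= b -> ccdf mu b <= ccdf mu a.
Proof. by move=> ab; rewrite -subr_ge0 -lee_fin -ccdf_itvoc. Qed.

Lemma ccdf_atom0 mu : mu `]-oo, 0[%classic = 0%E ->
  mu [set 0] = (1 - ccdf mu 0)%:E.
Proof.
move=> mu0; rewrite -ccdf_itvNyc.
have -> : `]-oo, 0]%classic = `]-oo, 0[ `|` [set 0] :> set R by rewrite setUitv1.
rewrite measureU//; first by rewrite [X in (_ = X + _)%E]mu0 add0e.
by rewrite -subset0 => x /= [+ x0]; rewrite x0 in_itv/= ltxx.
Qed.

(** Continuity from above along half-lines with empty intersection. The index is positive because it
    later serves as a horizon. *)
Lemma ccdf_lt_eventually mu (e : R) : 0 < e -> exists2 n : nat, (0 < n)%N & ccdf mu n%:R < e.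
Proof.
move=> e0; pose F n : set (measurableTypeR R) := `]n%:R, +oo[%classic.
have F0 : \bigcap_n F n = set0.
  rewrite -subset0 => x /(_ (Num.truncn x).+1 I).
  by rewrite /F/= in_itv/= andbT ltNge => /negP; apply; rewrite ltW// truncnS_gt.
have : mu \o F @ \oo --> mu (\bigcap_n F n).
  apply: nonincreasing_cvg_mu => //.
  - by rewrite -ge0_fin_numE// fin_num_measure//; exact: measurable_itv.
  - by move=> i; exact: measurable_itv.
  - by rewrite F0.
  - move=> m n mn; apply/subsetPset => x/=; rewrite /F/= !in_itv/= !andbT.
    by apply: le_lt_trans; rewrite ler_nat.
rewrite F0 measure0 => /fine_cvgP[_] /cvgrPdist_lt /(_ e e0)[N _ HN].
exists N.+1 => //; have := HN N.+1 (leqnSn N).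
by rewrite /= sub0r normrN ger0_norm ?ccdf_ge0.
Qed.


Lemma sum_grid_indic (c : nat -> R) (t : R) N x : 0 < t ->
  (~~ (0 < x <= N%:R * t) -> \sum_(j < N) c j * \1_(`]j%:R * t, j.+1%:R * t]%classic : set R) x = 0) /\
  (0 < x <= N%:R * t -> exists2 j, (j < N)%N & (j%:R * t < x <= j.+1%:R * t) /\
     \sum_(j < N) c j * \1_(`]j%:R * t, j.+1%:R * t]%classic : set R) x = c j).
Proof.
move=> t0; elim: N => [|N [IH0 IH1]].
  by split => [_|]; [rewrite big_ord0|rewrite mul0r; lra].
have NS : N.+1%:R * t = N%:R * t + t by rewrite -addn1 natrD mulrDl mul1r.
have N0 : 0 <= N%:R * t by rewrite mulr_ge0// ltW.
have Ein : (x \in (`]N%:R * t, N.+1%:R * t]%classic : set R)) = (N%:R * t < x <= N.+1%:R * t).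
  by apply/idP/idP; rewrite inE/= in_itv.
rewrite !big_ord_recr/= !indicE Ein.
have [xN|Nx] := leP x (N%:R * t).
  rewrite /= mulr0 addr0; split => [h|h].
    by apply: IH0; apply: contra h => /andP[-> _] /=; lra.
  have /IH1[j jN [jx ->]] : 0 < x <= N%:R * t by lra.
  by exists j => //; rewrite ltnS ltnW.
rewrite IH0 ?add0r; last by apply/negP => /andP[_]; rewrite leNgt Nx.
split => [h|/andP[x0 xN1]].
  rewrite [x <= _](_ : _ = false) ?mulr0//.
  by apply/negbTE; apply: contra h => ->; rewrite andbT; lra.
by exists N => //; rewrite xN1 Nx mulr1.
Qed.

(** Splits the mass of [mu] into the atom at 0, [N] cells of mesh [t] and the tail, with one lower
    bound for [f] on each. *)
Lemma integral_ge_grid mu (f : R -> \bar R) (t c0 ct : R) (c : nat -> R) (N : nat) :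
  mu `]-oo, 0[%classic = 0%E -> 0 < t ->
  (forall x, 0 <= f x)%E -> 0 <= c0 -> 0 <= ct -> (forall j, 0 <= c j) ->
  (c0%:E <= f 0%R)%E ->
  (forall j x, (j < N)%N -> j%:R * t < x <= j.+1%:R * t -> ((c j)%:E <= f x)%E) ->
  (forall x, N%:R * t < x -> (ct%:E <= f x)%E) ->
  ((c0 * (1 - ccdf mu 0) + ct * ccdf mu (N%:R * t) +
    \sum_(j < N) c j * (ccdf mu (j%:R * t) - ccdf mu (j.+1%:R * t)))%:E <=
   \int[mu]_x f x)%E.
Proof.
move=> mu0 t0 f0 c00 ct0 cj0 fc0 fcj fct.
(* Index 0 is the atom, 1 the tail and [j.+2] the cell [j]. *)
pose B (i : nat) : set (measurableTypeR R) := match i with 0%N => [set 0]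
  | 1%N => `]N%:R * t, +oo[%classic | j.+2 => `]j%:R * t, j.+1%:R * t]%classic end.
pose k (i : nat) : R := match i with 0%N => c0 | 1%N => ct | j.+2 => c j end.
have mB i : measurable (B i).
  by case: i => [|[|i]] /=; [exact: measurable_set1|exact: measurable_itv|exact: measurable_itv].
have k0 i : 0 <= k i by case: i => [|[|i]] /=.
have tj (j : nat) : j.+1%:R * t = j%:R * t + t by rewrite -addn1 natrD mulrDl mul1r.
have N0 : 0 <= N%:R * t by rewrite mulr_ge0// ltW.
have := @integral_ge_sum_indic _ _ _ mu setT f N.+2 k B measurableT (fun i _ => k0 i) (fun i _ => mB i).
rewrite !big_ord_recl/= => H; apply: le_trans (H _); last first.
  move=> x _; rewrite !big_ord_recl/= !indicE.
  have E1 : (x \in [set 0 : R]) = (x == 0) by apply/idP/idP; rewrite inE/= => /eqP.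
  have E2 : (x \in (`]N%:R * t, +oo[%classic : set R)) = (N%:R * t < x).
    by apply/idP/idP; rewrite inE/= in_itv/= andbT.
  rewrite E1 E2.
  have [S0 S1] := sum_grid_indic c N x t0.
  have [x0|x0|x0] := ltgtP x 0.
  - rewrite S0; last by apply/negP => /andP[]; lra.
    by rewrite ltNge (le_trans (ltW x0))//= !mulr0 !addr0.
  - have [xN|Nx] := leP x (N%:R * t).
      have [|j jN [jx ->]] := S1; first by lra.
      by rewrite !mulr0 !add0r; apply: fcj jx.
    rewrite S0; last by apply/negP => /andP[]; lra.
    by rewrite mulr0 mulr1 add0r addr0; apply: fct.
  - rewrite S0; last by apply/negP => /andP[]; lra.
    by rewrite x0 mulr1 ltNge N0 mulr0 !addr0.
rewrite !setIT ccdf_atom0// ccdfE !EFinD !EFinM addeA leeD2l// -sumEFin.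
apply: lee_sum => i _; rewrite setIT ccdf_itvoc ?EFinM// tj; lra.
Qed.

End law_lemmas.

(** * Transition probabilities *)

Section iid.
Context {R : realType}.
Implicit Types (mu : law R).

Lemma iid_expectation_ge_cst mu n (h : seq R -> \bar R) (c : R) : 0 <= c ->
  (forall us, (c%:E <= h us)%E) -> (c%:E <= iid_expectation mu n h)%E.
Proof.
move=> c0; elim: n h => [|n IH] h hc //=.
rewrite -[leLHS]mule1 -(@probability_setT _ _ _ mu) -integral_cst//.
apply: ge0_le_integral_nonmeasurable => [x _|x _]; first by rewrite lee_fin.
exact: IH.
Qed.

(* [win_avg p q n c] is E[1{min U_i >= w} / (1 + c + #{i | U_i = w})] for [n]
   i.i.d. workloads with P(U_i = w) = p and P(U_i > w) = q; the extra ties [c]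
   make the recursion on [n] close. *)
Fixpoint win_avg (p q : R) (n c : nat) : R :=
  if n is n'.+1 then p * win_avg p q n' c.+1 + q * win_avg p q n' c
  else c.+1%:R^-1.

Lemma win_avg_ge0 p q n c : 0 <= p -> 0 <= q -> 0 <= win_avg p q n c.
Proof.
by move=> p0 q0; elim: n c => [|n IH] c /=; rewrite ?addr_ge0// mulr_ge0.
Qed.

Lemma win_avg_le1 p q n c : 0 <= p -> 0 <= q -> p + q <= 1 -> win_avg p q n c <= 1.
Proof.
move=> p0 q0 pq; elim: n c => [|n IH] c /=.
  by rewrite invf_le1// ler1n.
apply: le_trans pq; apply: lerD; rewrite -[leRHS]mulr1; exact: ler_wpM2l.
Qed.

(* With [win_avg p q n c] = \int_0^1 x^c (q + p x)^n dx, this is integration by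
   parts. *)
Lemma win_avg_by_parts p q n c : p + q = 1 ->
  p * n.+1%:R * win_avg p q n c.+1 + c.+1%:R * win_avg p q n.+1 c = 1.
Proof.
move=> pq; elim: n c => [|n IH] c.
  rewrite /= mulr1; have -> : q = 1 - p by rewrite -pq; ring.
  have c1 : c.+1%:R != 0 :> R by rewrite pnatr_eq0.
  have c2 : c.+2%:R != 0 :> R by rewrite pnatr_eq0.
  have E : c.+2%:R = c.+1%:R + 1 :> R by rewrite -[c.+2]addn1 natrD.
  by rewrite E in c2 *; field; rewrite !nat1r c1 c2.
have E1 := IH c.+1; have E2 := IH c.
have -> : win_avg p q n.+2 c = p * win_avg p q n.+1 c.+1 + q * win_avg p q n.+1 c by [].
have -> : win_avg p q n.+1 c.+1 = p * win_avg p q n c.+2 + q * win_avg p q n c.+1 by [].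
have F : win_avg p q n.+1 c.+1 = p * win_avg p q n c.+2 + q * win_avg p q n c.+1 by [].
have Sc : c.+2%:R = c.+1%:R + 1 :> R by rewrite -[c.+2]addn1 natrD.
have Sn : n.+2%:R = n.+1%:R + 1 :> R by rewrite -[n.+2]addn1 natrD.
rewrite F Sc in E1; rewrite Sn.
rewrite -[RHS]pq -[X in _ = X + _]mulr1 -[X in _ = _ + X]mulr1 -[X in _ = p * X + _]E1.
by rewrite -[X in _ = _ + q * X]E2; ring.
Qed.

(** By symmetry: if no mass lies below the atom [p], each of [n.+1] queues is equally likely to win
    from the atom, and one of them does unless all lie above it. *)
Lemma win_avg_tie p q n : p + q = 1 ->
  p * n.+1%:R * win_avg p q n 0 = 1 - q ^+ n.+1.
Proof.
move=> pq; elim: n => [|n IH].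
  by rewrite /= invr1 expr1 -[in RHS]pq; ring.
have H := win_avg_by_parts n 0 pq.
have Sn : n.+2%:R = n.+1%:R + 1 :> R by rewrite -[n.+2]addn1 natrD.
rewrite mul1r in H.
have E : win_avg p q n.+1 0 = p * win_avg p q n 1 + q * win_avg p q n 0 by [].
have -> : p * n.+2%:R * win_avg p q n.+1 0 =
  p * (p * n.+1%:R * win_avg p q n 1 + win_avg p q n.+1 0) + q * (p * n.+1%:R * win_avg p q n 0).
  by rewrite Sn E; ring.
by rewrite H IH [q ^+ n.+2]exprS -[X in _ = X - _]pq; ring.
Qed.

Lemma win_avg_no_tie q n : win_avg 0 q n 0 = q ^+ n.
Proof. by elim: n => [|n IH] /=; rewrite ?invr1// mul0r add0r IH exprS. Qed.

(** Keeps only the event that every other workload is strictly larger. *)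
Lemma win_avg_ge p q n : 0 <= p -> 0 <= q -> q ^+ n <= win_avg p q n 0.
Proof.
move=> p0 q0; elim: n => [|n IH] /=; first by rewrite invr1.
by rewrite exprS ler_wpDl ?mulr_ge0 ?win_avg_ge0// ler_wpM2l.
Qed.

Lemma itv_split_point mu (v : R) :
  (mu `]-oo, v[%classic + mu [set v] + mu `]v, +oo[%classic)%E = 1%E.
Proof.
have <- : mu `]-oo, v]%classic = (mu `]-oo, v[%classic + mu [set v])%E.
  have -> : `]-oo, v]%classic = `]-oo, v[ `|` [set v] :> set R by rewrite setUitv1.
  rewrite measureU// -subset0 => x /= [+ xv].
  by rewrite xv in_itv/= ltxx.
rewrite ccdfE ccdf_itvNyc -EFinD; congr EFin; ring.
Qed.

(** [win_prob] with [c] extra ties, so that integrating out one tied workload stays within the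
    family. *)
Definition win_weight (v : R) (c : nat) (us : seq R) : R :=
  if all (fun u => v <= u) us then (count_mem v us + c).+1%:R^-1 else 0.

(** One workload is integrated out at a time: below [v] the queue loses, at [v] the number of ties
    grows, above [v] nothing changes. [a] and [b] bound the outcomes of joining and of not
    joining. *)
Lemma iid_expectation_win_ge mu (v a b : R) (a' b' : \bar R) n c :
  0 <= a -> 0 <= b -> (a%:E <= a')%E -> (b%:E <= b')%E ->
  let w := win_avg (fine (mu [set v])) (ccdf mu v) n c in
  is_true ((w * a + (1 - w) * b)%:E <=
   iid_expectation mu n (fun us => (win_weight v c us)%:E * a' +
                                   (1 - win_weight v c us)%:E * b'))%E.
Proof.
move=> a0 b0 aa bb w.
have mix (y : R) : 0 <= y <= 1 -> ((y * a + (1 - y) * b)%:E <= y%:E * a' + (1 - y)%:E * b')%E.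
  move=> /andP[y0 y1]; rewrite EFinD !EFinM; apply: leeD; apply: lee_wpmul2l => //.
  by rewrite lee_fin subr_ge0.
have cV k : 0 <= (k.+1%:R^-1 : R) <= 1.
  by rewrite invr_ge0 ler0n/= invf_le1// ler1n.
set p := fine (mu [set v]); set q := ccdf mu v.
have p0 : 0 <= p by rewrite fine_ge0.
have q0 : 0 <= q := ccdf_ge0 _ _.
have pE : mu [set v] = p%:E by rewrite fineK// fin_num_measure.
pose l := fine (mu `]-oo, v[%classic).
have lE : mu `]-oo, v[%classic = l%:E by rewrite fineK// fin_num_measure.
have lpq : l + p + q = 1.
  by apply: EFin_inj; rewrite !EFinD -lE -pE -ccdfE itv_split_point.
have l0 : 0 <= l by rewrite fine_ge0.
have pq : p + q <= 1 by rewrite -lpq -addrA lerDr.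
rewrite {}/w /win_weight; elim: n c => [|n IH] c /=.
  exact: mix.
set F := fun u : R => iid_expectation mu n _.
pose m k := win_avg p q n k * a + (1 - win_avg p q n k) * b.
have m0 k : 0 <= m k.
  by rewrite addr_ge0 ?mulr_ge0 ?win_avg_ge0// subr_ge0 win_avg_le1.
have F0 x : (0 <= F x)%E.
  apply: iid_expectation_ge_cst => // us.
  set y := (X in (X%:E * a')%E).
  have y01 : 0 <= y <= 1.
    by rewrite /y; case: ifP => _; [exact: cV|rewrite lexx ler01].
  apply: le_trans (mix _ y01).
  rewrite lee_fin addr_ge0// mulr_ge0//; first by case/andP: y01.
  by rewrite subr_ge0; case/andP: y01.
pose B (i : nat) : set (measurableTypeR R) := match i with 0%N => `]-oo, v[%classic
  | 1%N => [set v] | _ => `]v, +oo[%classic end.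
pose k (i : nat) : R := match i with 0%N => b | 1%N => m c.+1 | _ => m c end.
have mB i : measurable (B i).
  by case: i => [|[|i]] /=; [exact: measurable_itv|exact: measurable_set1|exact: measurable_itv].
have k0 i : 0 <= k i by case: i => [|[|i]] /=.
have := @integral_ge_sum_indic _ _ _ mu setT F 3 k B measurableT (fun i _ => k0 i) (fun i _ => mB i).
rewrite !big_ord_recl big_ord0/= => H; apply: le_trans (H _); last first.
  move=> x _; rewrite !big_ord_recl big_ord0 /= !indicE addr0.
  have E0 : (x \in (`]-oo, v[%classic : set R)) = (x < v) by apply/idP/idP; rewrite inE/= in_itv.
  have E1 : (x \in [set v]) = (x == v) by apply/idP/idP; rewrite inE/= => /eqP.
  have E2 : (x \in (`]v, +oo[%classic : set R)) = (v < x) by apply/idP/idP; rewrite inE/= in_itv/= andbT.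
  rewrite E0 E1 E2; have [xv|xv|xv] := ltgtP x v; rewrite !(mulr0,mulr1,addr0,add0r).
  - apply: iid_expectation_ge_cst => // us.
    by rewrite [v <= x]leNgt xv /= mul0e add0e subr0 mul1e.
  - apply: le_trans (IH c) _; rewrite le_eqVlt; apply/orP; left; apply/eqP.
    by congr iid_expectation; apply/funext => us; rewrite (ltW xv) gt_eqF//= add0n.
  - apply: le_trans (IH c.+1) _; rewrite le_eqVlt; apply/orP; left; apply/eqP.
    congr iid_expectation; apply/funext => us.
    by rewrite xv lexx eqxx /= add1n addSnnS.
rewrite !setIT adde0 -[mu `]-oo, v[%classic]/(mu _) lE pE ccdfE -!EFinM -!EFinD lee_fin.
rewrite /m -/q; have -> : l = 1 - p - q by rewrite -lpq; ring.
rewrite le_eqVlt; apply/orP; left; apply/eqP. rewrite /=; ring.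
Qed.

End iid.

(** * Transitions with at most one arrival *)

Section transition_bound.
Context {R : realType}.
Variables (d : nat) (G : law R) (lambda pi0 : R) (env : law R).
Hypotheses (lambda0 : 0 <= lambda) (pi0_ge0 : 0 <= pi0) (pi0_le1 : pi0 <= 1).

Local Notation Rp := (potential_rate d lambda pi0).
Local Notation Rm := (memory_rate lambda pi0 env 0).
Local Notation noarr := (no_arrival d lambda pi0 env).
Local Notation trans_upto := (transition_upto d G lambda pi0 env).
Local Notation win v := (win_avg (fine (env [set v])) (ccdf env v) d.-1 0).

Lemma potential_rate_ge0 : 0 <= Rp.
Proof. by rewrite /potential_rate !mulr_ge0. Qed.

Lemma memory_rate_ge0 v : 0 <= memory_rate lambda pi0 env v.
Proof.
rewrite /memory_rate; case: ifP => // _.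
by rewrite !mulr_ge0// ?invr_ge0 subr_ge0// ccdf_le1.
Qed.

Lemma atom_add_ccdf_le1 v : fine (env [set v]) + ccdf env v <= 1.
Proof.
rewrite -lee_fin EFinD fineK ?fin_num_measure// -ccdfE -(itv_split_point env v).
by rewrite -addeA leeDr.
Qed.

Lemma win01 v : 0 <= win v <= 1.
Proof.
by rewrite win_avg_ge0 ?ccdf_ge0 ?fine_ge0//= win_avg_le1 ?ccdf_ge0 ?fine_ge0// atom_add_ccdf_le1.
Qed.

Lemma no_arrival_ge0 s v : 0 <= noarr s v.
Proof. exact: expR_ge0. Qed.

Lemma after_potential_ge (h : R -> \bar R) v (a b : R) : 0 <= a -> 0 <= b ->
  (a%:E <= after_join G h v)%E -> (b%:E <= h v)%E ->
  ((win v * a + (1 - win v) * b)%:E <= after_potential d G env h v)%E.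
Proof.
move=> a0 b0 ha hb.
apply: le_trans (iid_expectation_win_ge env v d.-1 0 a0 b0 ha hb) _.
rewrite le_eqVlt; apply/orP; left; apply/eqP; congr iid_expectation.
apply/funext => us; rewrite /win_weight /win_prob.
by case: ifP => // _; rewrite addn0.
Qed.

Lemma transition_upto_ge0 n A t v : (0 <= trans_upto n A t v)%E.
Proof.
elim: n t v => [|n IH] t v /=.
  by rewrite adde0 mule_ge0// lee_fin ?no_arrival_ge0.
rewrite adde_ge0 ?mule_ge0 ?lee_fin ?no_arrival_ge0//.
apply: integral_ge0 => s _; rewrite mule_ge0 ?lee_fin ?no_arrival_ge0//.
have j0 : (0 <= after_join G (trans_upto n A (t - s)) (drain s v))%E by exact: integral_ge0.
rewrite adde_ge0// mule_ge0 ?lee_fin ?potential_rate_ge0 ?memory_rate_ge0//.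
apply: le_trans (after_potential_ge (lexx 0) (lexx 0) j0 (IH _ _)).
by rewrite !mulr0 addr0.
Qed.

Lemma transition_upto_le n A t v : (trans_upto n A t v <= transition d G lambda pi0 env A t v)%E.
Proof. by apply: ereal_sup_ubound; exists n. Qed.

Lemma transition_ge0 A t v : (0 <= transition d G lambda pi0 env A t v)%E.
Proof. exact: le_trans (transition_upto_ge0 0 A t v) (transition_upto_le _ _ _ _). Qed.

Lemma transition_ge_no_arrival (A : set R) t v : A (drain t v) ->
  ((noarr t v)%:E <= transition d G lambda pi0 env A t v)%E.
Proof.
move=> At; apply: le_trans (transition_upto_le 0 A t v).
by rewrite /= adde0 indicE mem_set// mule1.
Qed.

(** The queue is idle, and so exposed to memory arrivals, for at most the whole of [[0, s]]. *)
Lemma no_arrival_ge s v : 0 <= s -> 0 <= v -> expR (- ((Rp + Rm) * s)) <= noarr s v.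
Proof.
move=> s0 v0; rewrite /no_arrival ler_expR lerN2 mulrDl lerD2l.
by apply: ler_wpM2l; [exact: memory_rate_ge0|rewrite ge_max; lra].
Qed.

Lemma drain_ge0 (s v : R) : 0 <= drain s v.
Proof. by rewrite /drain le_max lexx orbT. Qed.

Lemma drainD (s t v : R) : 0 <= s -> s <= t -> drain (t - s) (drain s v) = drain t v.
Proof.
move=> s0 st; rewrite /drain.
case: (leP (v - s) 0) => h1; case: (leP (v - t) 0) => h2; case: leP; lra.
Qed.

(* Only trajectories with at most one arrival in [0, t] are counted. *)
Lemma transition_ge (A : set R) (B : set (measurableTypeR R)) (t v k b g : R) :
  b = \1_A (drain t v) -> G B = g%:E -> 0 <= t -> 0 <= v -> measurable B ->
  (forall s x : R, 0 <= s <= t -> B x -> 0 <= x /\ A (drain (t - s) (drain s v + x))) ->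
  0 <= k ->
  (forall s : R, 0 <= s <= t ->
    k <= Rp * (win (drain s v) * g + (1 - win (drain s v)) * b) +
         memory_rate lambda pi0 env (drain s v) * g) ->
  ((noarr t v * b + t * (expR (- ((Rp + Rm) * t)) * k))%:E <=
   transition d G lambda pi0 env A t v)%E.
Proof.
move=> bE gE t0 v0 mB BA k0 hk; apply: le_trans (transition_upto_le 1 A t v).
rewrite /= -bE EFinD EFinM leeD2l//.
set e := expR _.
rewrite mulrC EFinM.
(* [t] is the length of the range of [s], so the left side becomes the integral of a constant. *)
have -> : t%:E = lebesgue_measure `[0, t]%classic.
  rewrite lebesgue_measure_itv/= lte_fin; case: ltP => [_|t1]; first by rewrite -EFinB subr0.
  by congr EFin; lra.
rewrite -integral_cst//.
apply: ge0_le_integral_nonmeasurable => s /=; rewrite in_itv/= => st.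
  by rewrite lee_fin mulr_ge0// expR_ge0.
have /andP[s0 st'] := st.
(* Lower bound for the probability that an arrival at time [s] is the last one before [t]. *)
pose e2 := expR (- ((Rp + Rm) * (t - s))).
have g0 : 0 <= g by rewrite -lee_fin -gE.
have b0 : 0 <= b by rewrite bE indicE.
have e20 : 0 <= e2 := expR_ge0 _.
have T0 x : 0 <= x -> ((e2 * \1_A (drain (t - s) x))%:E <= trans_upto 0 A (t - s) x)%E.
  move=> x0; rewrite /= adde0 EFinM lee_wpmul2r ?lee_fin//.
  by apply: no_arrival_ge => //; rewrite subr_ge0.
have Tb : ((e2 * b)%:E <= trans_upto 0 A (t - s) (drain s v))%E.
  by rewrite bE -(drainD v s0 st'); apply: T0; exact: drain_ge0.
have Tg : ((e2 * g)%:E <= after_join G (trans_upto 0 A (t - s)) (drain s v))%E.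
  have := @integral_ge_sum_indic _ _ _ G setT
    (fun x => trans_upto 0 A (t - s) (drain s v + x)) 1 (fun=> e2) (fun=> B)
    measurableT (fun _ _ => e20) (fun _ _ => mB).
  rewrite big_ord1 setIT => H; rewrite EFinM -gE.
  apply: H => x _; rewrite big_ord1.
  have [xB|xB] := pselect (B x); last first.
    by rewrite indicE memNset// mulr0; exact: transition_upto_ge0.
  have [x0 Ax] := BA s x st xB.
  apply: le_trans (T0 (drain s v + x) _); last by rewrite addr_ge0// drain_ge0.
  by rewrite !indicE !mem_set.
have Tp := after_potential_ge (mulr_ge0 e20 g0) (mulr_ge0 e20 b0) Tg Tb.
apply: (@le_trans _ _ ((noarr s v)%:E * (Rp%:E *
    (win (drain s v) * (e2 * g) + (1 - win (drain s v)) * (e2 * b))%:E +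
    (memory_rate lambda pi0 env (drain s v))%:E * (e2 * g)%:E))%E).
  rewrite -[(Rp%:E * _)%E]EFinM -[((memory_rate _ _ _ _)%:E * _)%E]EFinM -EFinD -EFinM lee_fin.
  (* The no-arrival bounds before and after [s] multiply to a constant independent of [s]. *)
  have -> : e = expR (- ((Rp + Rm) * s)) * e2.
    by rewrite /e /e2 -expRD; congr expR; ring.
  rewrite -mulrA; apply: ler_pM; rewrite ?expR_ge0 ?mulr_ge0//.
    exact: no_arrival_ge.
  apply: le_trans (ler_wpM2l e20 (hk s st)) _.
  by rewrite le_eqVlt; apply/orP; left; apply/eqP; ring.
rewrite lee_wpmul2l ?lee_fin ?no_arrival_ge0//.
apply: leeD; apply: lee_wpmul2l => //; rewrite lee_fin.
- exact: potential_rate_ge0.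
- exact: memory_rate_ge0.
Qed.

End transition_bound.

(** * One-step bounds from stationarity *)

Section stationary_bounds.
Context {R : realType}.
Variables (d : nat) (G : law R) (lambda pi0 : R) (mu : law R).
Hypotheses (lambda0 : 0 <= lambda) (pi0_ge0 : 0 <= pi0) (pi0_le1 : pi0 <= 1).
Hypothesis G_pos : ccdf G 0 = 1.
Hypothesis mu_neg : mu `]-oo, 0[%classic = 0%E.
Hypothesis mu_atomless : forall v, 0 < v -> mu [set v] = 0%E.
Hypothesis mu_stat : stationary d G lambda pi0 mu mu.

Local Notation Rp := (potential_rate d lambda pi0).
Local Notation Rm := (memory_rate lambda pi0 mu 0).
Local Notation win v := (win_avg (fine (mu [set v])) (ccdf mu v) d.-1 0).
Local Notation u := (ccdf mu).
Local Notation H := (ccdf G).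

Let Rp0 : 0 <= Rp := potential_rate_ge0 d lambda0 pi0_ge0.
Let Rm0 : 0 <= Rm := memory_rate_ge0 mu lambda0 pi0_le1 0.
Let H1 x : 0 <= 1 - H x. Proof. by rewrite subr_ge0 ccdf_le1. Qed.

Lemma grid_succ (j : nat) (t : R) : j.+1%:R * t = j%:R * t + t.
Proof. by rewrite -natr1 mulrDl mul1r. Qed.

Lemma expR_ge_sub (x : R) : 1 - x <= expR (- x).
Proof. exact: expR_ge1Dx. Qed.

(** Without arrivals, every start in [[0, w + t]] has drained into [[0, w]] by time [t].
    Stationarity compares the masses of the two intervals, and an arrival has probability at most
    [(Rp + Rm) * t]. *)
Lemma ccdf_lipschitz w t : 0 <= w -> 0 <= t -> u w - u (w + t) <= (Rp + Rm) * t.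
Proof.
move=> w0 t0.
have L0 : 0 <= Rp + Rm by rewrite addr_ge0.
have [->|tn0] := eqVneq t 0; first by rewrite addr0 subrr mulr0.
have wt : 0 < w + t by rewrite ltr_wpDl// lt_neqAle eq_sym tn0.
pose e := expR (- ((Rp + Rm) * t)).
have e0 : 0 <= e := expR_ge0 _.
have K x : 0 <= x <= w + t ->
    (e%:E <= transition d G lambda pi0 mu `]-oo, w]%classic t x)%E.
  move=> /andP[x0 xwt]; apply: le_trans (transition_ge_no_arrival _ _ _ _ _ _).
    by rewrite lee_fin; apply: no_arrival_ge.
  by rewrite /= in_itv/= /drain ge_max; lra.
(* The grid has the single cell []0, w + t]], and the tail is bounded by 0. *)
have := @integral_ge_grid R mu (transition d G lambda pi0 mu `]-oo, w]%classic t)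
  (w + t) e 0 (fun=> e) 1 mu_neg wt (transition_ge0 _ _ _ _ _ _ _ _) e0 (lexx 0) (fun=> e0).
rewrite mu_stat// ccdf_itvNyc big_ord1 !mul0r !mul1r addr0 lee_fin.
move=> /(_ lambda0 pi0_ge0 pi0_le1 (K 0 _)) B.
have {}B : e * (1 - u 0) + e * (u 0 - u (w + t)) <= 1 - u w.
  apply: B; first by rewrite lexx ltW.
  - by case=> // x _; rewrite mul0r mul1r => /andP[x0 xwt]; apply: K; rewrite xwt ltW.
  - by move=> x _; exact: transition_ge0.
have el := expR_ge_sub ((Rp + Rm) * t).
have e1 : e <= 1 by rewrite /e -expR0 ler_expR oppr_le0 mulr_ge0.
have uw : (1 - e) * (1 - u (w + t)) <= 1 - e.
  by rewrite ler_piMr ?subr_ge0// lerBlDr lerDl ccdf_ge0.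
by rewrite -/e in el; lra.
Qed.

(** Ways to be above [k t] at time [t]: from 0, by joining of a job larger than [(k + 1) t]; from
    cell [j], by winning a potential arrival with a job larger than [(k + 1 - j) t]; from beyond
    [(k + 1) t], with no arrival or with one, whatever its outcome. In the last case the queue stays
    busy, so only potential arrivals occur. *)
Lemma ccdf_step_lower (k : nat) (t e : R) : 0 < t -> e = expR (- ((Rp + Rm) * t)) ->
  t * (e * ((Rp * win 0 + Rm) * H (k.+1%:R * t))) * (1 - u 0) +
  (expR (- (Rp * t)) + t * (e * Rp)) * u (k.+1%:R * t) +
  \sum_(j < k.+1) t * (e * (Rp * u (j.+1%:R * t) ^+ d.-1 * H ((k.+1 - j)%:R * t))) *
     (u (j%:R * t) - u (j.+1%:R * t)) <= u (k%:R * t).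
Proof.
move=> t0 {e}->; set e := expR (- ((_ + _) * t)); have t0' := ltW t0.
have e0 : 0 <= e := expR_ge0 _.
have kt0 : 0 <= k%:R * t by rewrite mulr_ge0.
have w0 v := win01 d mu v.
rewrite -lee_fin -[leRHS]ccdfE -(mu_stat t0' (measurable_itv _)).
apply: (integral_ge_grid (c := fun j =>
  t * (e * (Rp * u (j.+1%:R * t) ^+ d.-1 * H ((k.+1 - j)%:R * t))))) => //.
- by move=> x; exact: transition_ge0.
- by have /andP[? _] := w0 0; rewrite !(mulr_ge0, addr_ge0)// ccdf_ge0.
- by rewrite addr_ge0 ?mulr_ge0// expR_ge0.
- by move=> j; rewrite !mulr_ge0// ?exprn_ge0 ?ccdf_ge0.
- apply: le_trans (transition_ge (B := `]k.+1%:R * t, +oo[%classic)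
    (k := (Rp * win 0 + Rm) * H (k.+1%:R * t)) (b := 0) lambda0 pi0_ge0 pi0_le1 _
    (ccdfE _ _) t0' (lexx _) _ _ _ _) => //.
  + by rewrite mulr0 add0r.
  + rewrite indicE memNset//= in_itv/= andbT /drain sub0r.
    by apply/negP; rewrite -leNgt ge_max; lra.
  + move=> s x /andP[s0 st]; rewrite /= !in_itv/= !andbT grid_succ /drain sub0r => xt.
    by rewrite lt_max; case: (leP (- s) 0); lra.
  + by have /andP[? _] := w0 0; rewrite !(mulr_ge0, addr_ge0)// ccdf_ge0.
  + move=> s /andP[s0 st]; have -> : drain s 0 = 0 :> R.
      by rewrite /drain sub0r max_r// oppr_le0.
    by rewrite le_eqVlt; apply/orP; left; apply/eqP; ring.
- move=> j x jk /andP[jx xj].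
  have j0 : 0 <= j%:R * t by rewrite mulr_ge0.
  have x0 : 0 <= x by lra.
  have Ekj : (k.+1 - j)%:R * t = k%:R * t + t - j%:R * t.
    by rewrite natrB ?mulrBl ?grid_succ// ltnW.
  have kj0 : 0 <= (k.+1 - j)%:R * t by rewrite mulr_ge0.
  apply: le_trans (transition_ge (B := `](k.+1 - j)%:R * t, +oo[%classic)
    (k := Rp * u (j.+1%:R * t) ^+ d.-1 * H ((k.+1 - j)%:R * t)) lambda0 pi0_ge0 pi0_le1
    erefl (ccdfE _ _) t0' x0 _ _ _ _) => //.
  + by rewrite lee_fin lerDr mulr_ge0 ?no_arrival_ge0// indicE.
  + move=> s y /andP[s0 st]; rewrite /= !in_itv/= !andbT Ekj /drain => yt; split.
      by lra.
    by rewrite lt_max; case: (leP (x - s) 0); lra.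
  + by rewrite !mulr_ge0// ?exprn_ge0 ?ccdf_ge0.
  + move=> s /andP[s0 st]; have /andP[wi0 wi1] := w0 (drain s x).
    (* The workload at the arrival is at most the right end of the cell, so another workload exceeds
       it with probability at least [u (j.+1%:R * t)]. *)
    apply: (@le_trans _ _ (Rp * (win (drain s x) * H ((k.+1 - j)%:R * t)))).
      rewrite -mulrA ler_wpM2l// ler_wpM2r ?ccdf_ge0//.
      apply: le_trans (win_avg_ge _ _ (ccdf_ge0 _ _)); last by rewrite fine_ge0.
      rewrite lerXn2r ?nnegrE ?ccdf_ge0//; apply: ccdf_nincr.
      by rewrite /drain ge_max; lra.
    rewrite [leRHS]addrC ler_wpDl ?mulr_ge0 ?ccdf_ge0 ?memory_rate_ge0//.
    by rewrite ler_wpM2l// lerDl mulr_ge0 ?subr_ge0// indicE.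
- move=> x kx; rewrite grid_succ in kx.
  have x0 : 0 <= x by lra.
  apply: le_trans (transition_ge (B := `]0, +oo[%classic) (g := 1) (b := 1)
    (k := Rp) lambda0 pi0_ge0 pi0_le1 _ _ t0' x0 _ _ _ _) => //.
  + rewrite mulr1 /no_arrival max_r ?mulr0 ?addr0//; lra.
  + by rewrite indicE mem_set//= in_itv/= andbT /drain lt_max; apply/orP; left; lra.
  + by rewrite ccdfE G_pos.
  + move=> s y /andP[s0 st]; rewrite /= !in_itv/= !andbT /drain => yt; split.
      exact: ltW.
    by rewrite lt_max; case: (leP (x - s) 0); lra.
  + move=> s _; set p := win_avg _ _ _ _; set m := memory_rate _ _ _ (drain s x).
    have : 0 <= m by exact: memory_rate_ge0.
    have -> : Rp * (p * 1 + (1 - p) * 1) + m * 1 = Rp + m by ring.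
    by rewrite lerDl.
Qed.

(** Ways to be at most [k t] at time [t]. From 0: no arrival, a job of size at most [k t], or a lost
    potential arrival. From []0, t]], where the queue may empty, only the case of no arrival is
    kept. From the cell [j.+1]: no arrival, or a potential arrival that is not both won and larger
    than [(k - j - 1) t]. *)
Lemma ccdf_step_upper (k : nat) (t e : R) : 0 < t -> e = expR (- ((Rp + Rm) * t)) ->
  (e + t * (e * ((Rp * win 0 + Rm) * (1 - H (k%:R * t)) + Rp * (1 - win 0)))) * (1 - u 0) +
  (e * (u 0 - u t) +
  \sum_(j < k) (expR (- (Rp * t)) + t * (e * (Rp * (1 - u (j%:R * t) ^+ d.-1 * H ((k - j.+1)%:R * t))))) *
     (u (j.+1%:R * t) - u (j.+2%:R * t))) <= 1 - u (k%:R * t).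
Proof.
move=> t0 {e}->; set e := expR (- ((_ + _) * t)); have t0' := ltW t0.
have e0 : 0 <= e := expR_ge0 _.
have kt0 : 0 <= k%:R * t by rewrite mulr_ge0.
have w0 v := win01 d mu v.
pose c j : R := if j is j.+1 then
  expR (- (Rp * t)) + t * (e * (Rp * (1 - u (j%:R * t) ^+ d.-1 * H ((k - j.+1)%:R * t))))
  else e.
have uH (i j : R) : 0 <= u i ^+ d.-1 * H j <= 1.
  rewrite mulr_ge0 ?exprn_ge0 ?ccdf_ge0//=.
  by rewrite mulr_ile1 ?exprn_ge0 ?exprn_ile1 ?ccdf_ge0 ?ccdf_le1.
have := @integral_ge_grid R mu (transition d G lambda pi0 mu `]-oo, k%:R * t]%classic t)
  t (e + t * (e * ((Rp * win 0 + Rm) * (1 - H (k%:R * t)) + Rp * (1 - win 0)))) 0 c k.+1.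
have k0 : 0 <= (Rp * win 0 + Rm) * (1 - H (k%:R * t)) + Rp * (1 - win 0).
  have /andP[p0 p1] := w0 0.
  by rewrite addr_ge0// mulr_ge0// ?subr_ge0// addr_ge0// mulr_ge0.
rewrite mu_stat// ccdf_itvNyc lee_fin mul0r addr0 big_ord_recl mul0r mul1r => B; apply: B => //.
- by move=> x; exact: transition_ge0.
- by rewrite addr_ge0// mulr_ge0// mulr_ge0//.
- case=> [|j]//=; rewrite addr_ge0 ?expR_ge0// !mulr_ge0// subr_ge0.
  by have /andP[] := uH (j%:R * t) ((k - j.+1)%:R * t).
- apply: le_trans (transition_ge (B := `]0, k%:R * t]%classic) (g := 1 - H (k%:R * t))
    (k := (Rp * win 0 + Rm) * (1 - H (k%:R * t)) + Rp * (1 - win 0)) (b := 1)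
    lambda0 pi0_ge0 pi0_le1 _ _ t0' (lexx _) _ _ _ _) => //.
  + by rewrite mulr1 /no_arrival subr0 max_l// -mulrDl.
  + rewrite indicE mem_set//= in_itv/= /drain sub0r ge_max; lra.
  + by rewrite ccdf_itvoc// G_pos.
  + move=> s x /andP[s0 st]; rewrite /= !in_itv/= /drain sub0r => xt.
    by rewrite ge_max; case: (leP (- s) 0); lra.
  + move=> s /andP[s0 st]; have -> : drain s 0 = 0 :> R.
      by rewrite /drain sub0r max_r// oppr_le0.
    by rewrite le_eqVlt; apply/orP; left; apply/eqP; ring.
- case=> [|j] x jk /andP[jx xj] /=.
    rewrite mul0r mul1r in jx xj.
    apply: le_trans (transition_ge_no_arrival _ _ _ _ _ _).
      by rewrite lee_fin; apply: no_arrival_ge => //; exact: ltW.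
    by rewrite /= in_itv/= /drain ge_max; lra.
  rewrite ltnS in jk; rewrite !grid_succ in jx xj.
  have j0 : 0 <= j%:R * t by rewrite mulr_ge0.
  have x0 : 0 <= x by lra.
  have Ekj : (k - j.+1)%:R * t = k%:R * t - (j%:R * t + t).
    by rewrite natrB ?mulrBl ?grid_succ.
  have kj0 : 0 <= (k - j.+1)%:R * t by rewrite mulr_ge0.
  apply: le_trans (transition_ge (B := `]0, (k - j.+1)%:R * t]%classic)
    (k := Rp * (1 - u (j%:R * t) ^+ d.-1 * H ((k - j.+1)%:R * t))) (b := 1)
    (g := 1 - H ((k - j.+1)%:R * t)) lambda0 pi0_ge0 pi0_le1 _ _ t0' x0 _ _ _ _) => //.
  + rewrite mulr1 /no_arrival max_r ?mulr0 ?addr0//; lra.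
  + by rewrite indicE mem_set//= in_itv/= /drain ge_max; lra.
  + by rewrite ccdf_itvoc// G_pos.
  + move=> s y /andP[s0 st]; rewrite /= !in_itv/= Ekj /drain => yt; split.
      by lra.
    by rewrite ge_max; case: (leP (x - s) 0); lra.
  + by rewrite mulr_ge0// subr_ge0; have /andP[] := uH (j%:R * t) ((k - j.+1)%:R * t).
  + move=> s /andP[s0 st].
    have -> : drain s x = x - s by rewrite /drain max_l//; lra.
    (* The workload [x - s] at the arrival is still positive, where ties have probability 0, so
       winning has probability exactly [u (x - s) ^+ d.-1]. *)
    rewrite mu_atomless ?win_avg_no_tie; last by lra.
    have um : u (x - s) ^+ d.-1 <= u (j%:R * t) ^+ d.-1.
      by rewrite lerXn2r ?nnegrE ?ccdf_ge0//; apply: ccdf_nincr; lra.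
    set h := H _; have h0 : 0 <= h by exact: ccdf_ge0.
    rewrite [leRHS]addrC ler_wpDl ?mulr_ge0 ?memory_rate_ge0 ?H1//.
    rewrite ler_wpM2l//.
    have := ler_wpM2r h0 um; lra.
- by move=> x _; exact: transition_ge0.
Qed.

End stationary_bounds.

(** * A discrete Volterra equation *)

Section power_bounds.
Context {R : realType}.
Implicit Types x y z : R.

(** Mean value bound with the derivative at the right end point; the next lemma takes the left
    one. *)
Lemma subrX_le n x y : 0 <= y <= x -> x ^+ n.+1 - y ^+ n.+1 <= n.+1%:R * x ^+ n * (x - y).
Proof.
move=> /andP[y0 yx]; elim: n => [|n IH]; first by rewrite !expr1 expr0; lra.
have x0 : 0 <= x by lra.
have yxn : y ^+ n.+1 <= x ^+ n.+1 by rewrite lerXn2r// nnegrE.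
have E : x ^+ n.+2 - y ^+ n.+2 = x * (x ^+ n.+1 - y ^+ n.+1) + y ^+ n.+1 * (x - y).
  by rewrite [x ^+ n.+2]exprS [y ^+ n.+2]exprS; ring.
have := ler_wpM2l x0 IH.
have : y ^+ n.+1 * (x - y) <= x ^+ n.+1 * (x - y) by rewrite ler_wpM2r// subr_ge0.
rewrite E -[n.+2%:R]natr1 => A B; apply: le_trans (lerD B A) _.
by rewrite le_eqVlt; apply/orP; left; apply/eqP; rewrite exprS; ring.
Qed.

Lemma subrX_ge n x y : 0 <= y <= x -> n.+1%:R * y ^+ n * (x - y) <= x ^+ n.+1 - y ^+ n.+1.
Proof.
move=> /andP[y0 yx]; elim: n => [|n IH]; first by rewrite !expr1 expr0; lra.
have x0 : 0 <= x by lra.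
have E : x ^+ n.+2 - y ^+ n.+2 = x * (x ^+ n.+1 - y ^+ n.+1) + y ^+ n.+1 * (x - y).
  by rewrite [x ^+ n.+2]exprS [y ^+ n.+2]exprS; ring.
have dX : 0 <= x ^+ n.+1 - y ^+ n.+1 by rewrite subr_ge0 lerXn2r// nnegrE.
rewrite E; have := ler_wpM2l y0 IH; have := ler_wpM2r dX yx.
rewrite -[n.+2%:R]natr1 [y ^+ n.+1]exprS; lra.
Qed.

Lemma subrX_le1 n x y : 0 <= y <= x -> x <= 1 -> x ^+ n - y ^+ n <= n%:R * (x - y).
Proof.
move=> /andP[y0 yx] x1; case: n => [|n]; first by rewrite !expr0 subrr mul0r.
apply: le_trans (subrX_le _ _) _; first by rewrite y0.
by rewrite ler_wpM2r ?subr_ge0// ler_piMr// exprn_ile1// (le_trans y0).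
Qed.

(** Taking the slope at [z] costs an error of second order. In the upper step, the winning
    probability is evaluated to the left of the increment of the ccdf, and [z] is its value
    there. *)
Lemma subrX_ge_error n x y z : 0 <= y <= x -> x <= z -> z <= 1 ->
  n.+1%:R * z ^+ n * (x - y) <= x ^+ n.+1 - y ^+ n.+1 + n.+1%:R ^+ 2 * (z - y) ^+ 2.
Proof.
move=> /andP[y0 yx] xz z1.
have := @subrX_ge n x y; rewrite y0 yx => /(_ isT) A.
have := @subrX_le1 n z y; rewrite y0 (le_trans yx xz) => /(_ isT z1) B.
have n0 : 0 <= n%:R :> R by [].
have C : (z ^+ n - y ^+ n) * (x - y) <= n%:R * (z - y) * (z - y).
  apply: le_trans (ler_wpM2r _ B) _; first by lra.
  by apply: ler_wpM2l; [rewrite mulr_ge0//; lra|lra].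
have D : n%:R * (z - y) * (z - y) <= n.+1%:R * (z - y) ^+ 2.
  by rewrite -mulrA -expr2 ler_wpM2r ?sqr_ge0// ler_nat.
have := ler_wpM2l (ler0n R n.+1) (le_trans C D); lra.
Qed.

Lemma distrX_le n x y : 0 <= x <= 1 -> 0 <= y <= 1 -> `|x ^+ n - y ^+ n| <= n%:R * `|x - y|.
Proof.
wlog yx : x y / y <= x => [H|] x01 y01.
  have [yx|/ltW xy] := leP y x; first exact: H.
  by rewrite distrC [`|x - y|]distrC H.
case/andP: x01 => x0 x1; case/andP: y01 => y0 _.
rewrite !ger0_norm ?subr_ge0// ?lerXn2r ?nnegrE//.
by apply: subrX_le1; rewrite ?y0.
Qed.

End power_bounds.

(** * Discrete convolutions and Gronwall's inequality *)

Section discrete_convolution.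
Context {R : realType}.
Implicit Types g x : nat -> R.

(** With [g i = H (i t)], [t] times this is the left Riemann sum of \int_0^w H(s) (1 - x(w - s)) ds
    at [w = K t]. *)
Definition conv_sum g x K : R := \sum_(i < K) g i * (1 - x (K - i)%N).

(** The increment separates arrivals at an idle queue, the term with [1 - x 0], from arrivals at a
    workload in cell [j], which is the shape of the one-step bounds. *)
Lemma conv_sumS g x K :
  conv_sum g x K.+1 - conv_sum g x K =
  (1 - x 0%N) * g K + \sum_(j < K.+1) g (K - j)%N * (x j - x j.+1).
Proof.
have -> : \sum_(j < K.+1) g (K - j)%N * (x j - x j.+1) =
          \sum_(i < K.+1) g i * (x (K - i)%N - x (K.+1 - i)%N).
  rewrite (reindex_inj rev_ord_inj)/=; apply: eq_bigr => i _.
  have iK : (i <= K)%N by rewrite -ltnS.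
  by rewrite subSS subKn// subSn.
rewrite /conv_sum !big_ord_recr/= subSnn subnn.
have -> : \sum_(i < K) g i * (x (K - i)%N - x (K.+1 - i)%N) =
  \sum_(i < K) g i * (1 - x (K.+1 - i)%N) - \sum_(i < K) g i * (1 - x (K - i)%N).
  by rewrite -sumrB; apply: eq_bigr => i _; ring.
ring.
Qed.

Lemma telescope_ord x K : \sum_(i < K) (x i - x i.+1) = x 0%N - x K.
Proof.
elim: K => [|K IH]; first by rewrite big_ord0 subrr.
by rewrite big_ord_recr/= IH; ring.
Qed.

(** [B * (1 + A) ^+ k] satisfies the recursion with equality, so it dominates by strong
    induction. *)
Lemma discrete_gronwall (delta : nat -> R) (A B : R) K :
  0 <= A -> (forall k, (k <= K)%N -> delta k <= A * \sum_(j < k) delta j + B) ->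
  forall k, (k <= K)%N -> delta k <= B * (1 + A) ^+ k.
Proof.
move=> A0 H; have E k : A * \sum_(j < k) (B * (1 + A) ^+ j) + B = B * (1 + A) ^+ k.
  elim: k => [|k IH]; first by rewrite big_ord0 mulr0 add0r expr0 mulr1.
  by rewrite big_ord_recr/= mulrDr addrAC IH exprS; ring.
elim/ltn_ind => k IH kK; apply: le_trans (H k kK) _; rewrite -E lerD2r ler_wpM2l//.
by apply: ler_sum => j _; apply: IH => //; exact: leq_trans (ltnW (ltn_ord j)) kK.
Qed.

End discrete_convolution.

(** * Level crossings over one mesh step *)

Section volterra_step.
Context {R : realType}.
Variables (n : nat) (lambda pi0 L Rp b0 w0 t e e' : R) (U g : nat -> R) (k : nat).
Hypotheses (lambda0 : 0 <= lambda) (pi00 : 0 <= pi0) (pi01 : pi0 <= 1).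
Hypotheses (Rp0 : 0 <= Rp) (RpL : Rp <= L) (RpE : Rp = lambda * n.+1%:R * pi0).
Hypotheses (t0 : 0 <= t) (e_ge : 1 - L * t <= e) (e'_ge : 1 - Rp * t <= e').
Hypotheses (U0 : forall j, 0 <= U j) (U1 : forall j, U j <= 1).
Hypothesis U_nincr : forall j, U j.+1 <= U j.
Hypothesis U_lip : forall j, U j - U j.+1 <= L * t.
Hypotheses (g0 : forall j, 0 <= g j) (g1 : forall j, g j <= 1).

Let x j : R := pi0 * U j ^+ n.+1.
Hypothesis b0E : b0 * (1 - U 0%N) = lambda * (1 - x 0%N).

Let L0 : 0 <= L. Proof. exact: le_trans RpL. Qed.
Let n0 : 0 <= n.+1%:R :> R. Proof. by []. Qed.

Let x_ge0 j : 0 <= x j. Proof. by rewrite mulr_ge0// exprn_ge0. Qed.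
Let x_le1 j : x j <= 1. Proof. by rewrite mulr_ile1 ?exprn_ge0// exprn_ile1. Qed.
Let x_nincr j : x j.+1 <= x j.
Proof. by rewrite ler_wpM2l// lerXn2r// nnegrE. Qed.

(** [L] stands for [Rp + Rm], [b0] for the rate of joining an idle queue, [e] and [e'] for
    no-arrival probabilities. To first order in [t] the hypothesis yields the increment of
    [conv_sum], since [n.+1 * U ^+ n] times an increment of [U] is close to that of [U ^+ n.+1].
    Each cell costs an error of order [t ^+ 3], the other terms one of order [t ^+ 2]. *)
Lemma volterra_step_lower :
  t * (e * (b0 * g k.+1)) * (1 - U 0%N) + (e' + t * (e * Rp)) * U k.+1 +
  \sum_(j < k.+1) t * (e * (Rp * U j.+1 ^+ n * g (k.+1 - j)%N)) * (U j - U j.+1)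
    <= U k ->
  lambda * t * (conv_sum (g \o S) x k.+1 - conv_sum (g \o S) x k) -
    t ^+ 2 * (2 * L ^+ 2 + L * lambda + lambda * n.+1%:R ^+ 2 * L ^+ 2 * (k.+1%:R * t))
    <= U k - U k.+1.
Proof.
rewrite conv_sumS /=.
under [in X in X -> _]eq_bigr do rewrite -(mulrA t) -(mulrA e) -!(mulrA Rp).
rewrite -mulr_sumr -mulr_sumr -mulr_sumr.
set S := \sum_(j < k.+1) _; set S' := \sum_(j < k.+1) _ => H.
have dU j : 0 <= U j - U j.+1 by rewrite subr_ge0.
have Un j : 0 <= U j ^+ n <= 1 by rewrite exprn_ge0//= exprn_ile1.
have S0 : 0 <= S.
  by apply: sumr_ge0 => j _; rewrite !mulr_ge0//; case/andP: (Un j.+1).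
have S1 : S <= 1.
  apply: (@le_trans _ _ (\sum_(j < k.+1) (U j - U j.+1))).
    apply: ler_sum => j _; rewrite ler_piMl// mulr_ile1//; by case/andP: (Un j.+1).
  by rewrite telescope_ord; have := U0 k.+1; have := U1 0%N; lra.
have SS : lambda * S' - lambda * n.+1%:R ^+ 2 * L ^+ 2 * t ^+ 2 * k.+1%:R <= Rp * S.
  pose D : R := n.+1%:R ^+ 2 * (L ^+ 2 * t ^+ 2).
  have -> : lambda * n.+1%:R ^+ 2 * L ^+ 2 * t ^+ 2 * k.+1%:R = lambda * \sum_(j < k.+1) D.
    by rewrite sumr_const card_ord -(mulr_natr D) /D; ring.
  have -> : Rp * S = lambda * \sum_(j < k.+1)
      n.+1%:R * (pi0 * (U j.+1 ^+ n * (g (k.+1 - j)%N * (U j - U j.+1)))).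
    by rewrite RpE /S !mulr_sumr; apply: eq_bigr => j _; ring.
  rewrite -mulrBr ler_wpM2l// -sumrB; apply: ler_sum => j _.
  have -> : g (k - j).+1 = g (k.+1 - j)%N by rewrite subSn// -ltnS.
  set gj := g _; have gj0 : 0 <= gj by exact: g0.
  have gj1 : gj <= 1 by exact: g1.
  have A : U j ^+ n.+1 - U j.+1 ^+ n.+1 <=
      n.+1%:R * U j.+1 ^+ n * (U j - U j.+1) + n.+1%:R ^+ 2 * (L ^+ 2 * t ^+ 2).
    have := @subrX_le R n (U j) (U j.+1); rewrite U0 U_nincr => /(_ isT) A1.
    have := @subrX_le1 R n (U j) (U j.+1); rewrite U0 U_nincr => /(_ isT (U1 j)) A2.
    have A3 : (U j ^+ n - U j.+1 ^+ n) * (U j - U j.+1) <= n.+1%:R * (L ^+ 2 * t ^+ 2).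
      apply: (@le_trans _ _ (n.+1%:R * (U j - U j.+1) * (U j - U j.+1))).
        rewrite ler_wpM2r// (le_trans A2)// ler_wpM2r// ler_nat//.
      rewrite -mulrA ler_wpM2l// -exprMn -expr2 lerXn2r// ?nnegrE//.
      exact: le_trans (U_lip j).
    have := ler_wpM2l n0 A3; lra.
  rewrite -/D in A.
  have D0 : 0 <= D by rewrite !mulr_ge0// exprn_ge0.
  rewrite /x -mulrBr.
  apply: (@le_trans _ _ (gj * (pi0 * (U j ^+ n.+1 - U j.+1 ^+ n.+1)) - gj * pi0 * D)).
    by rewrite lerD2l lerN2 ler_piMl// mulr_ile1.
  rewrite mulrA -mulrBr.
  have -> : n.+1%:R * (pi0 * (U j.+1 ^+ n * (gj * (U j - U j.+1)))) =
     (gj * pi0) * (n.+1%:R * U j.+1 ^+ n * (U j - U j.+1)) by ring.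
  by rewrite ler_wpM2l ?mulr_ge0// lerBlDr.
have c01 : 0 <= 1 - x 0%N <= 1 by rewrite subr_ge0 x_le1 lerBlDr lerDl x_ge0.
have B1 : t * (1 - L * t) * (lambda * (1 - x 0%N)) * g k.+1 <=
          t * (e * (b0 * g k.+1)) * (1 - U 0%N).
  have -> : t * (e * (b0 * g k.+1)) * (1 - U 0%N) = t * e * (b0 * (1 - U 0%N)) * g k.+1 by ring.
  rewrite b0E ler_wpM2r// ler_wpM2r// ?ler_wpM2l//.
  by rewrite mulr_ge0//; case/andP: c01.
(* No arrival and one arrival both keep the workload above the level, so the terms of first order
   cancel. *)
have B2 : (1 - L ^+ 2 * t ^+ 2) * U k.+1 <= (e' + t * (e * Rp)) * U k.+1.
  rewrite ler_wpM2r//; have := ler_wpM2l (mulr_ge0 t0 Rp0) e_ge.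
  have : Rp * (L * t ^+ 2) <= L * (L * t ^+ 2).
    by rewrite ler_wpM2r// mulr_ge0// exprn_ge0.
  have := e'_ge; lra.
have B3 : t * (Rp * S) - L ^+ 2 * t ^+ 2 <= t * (e * (Rp * S)).
  have := ler_wpM2l (mulr_ge0 t0 (mulr_ge0 Rp0 S0)) e_ge.
  have : Rp * S * (L * t ^+ 2) <= L * (L * t ^+ 2).
    by rewrite ler_wpM2r// ?mulr_ge0 ?exprn_ge0// (le_trans _ RpL)// ler_piMr.
  lra.
have B4 : L * t ^+ 2 * ((lambda * (1 - x 0%N)) * g k.+1) <= L * t ^+ 2 * lambda.
  rewrite ler_wpM2l ?mulr_ge0 ?exprn_ge0// -mulrA ler_piMr//.
  by case/andP: c01 => *; rewrite mulr_ile1.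
have B5 : L ^+ 2 * t ^+ 2 * U k.+1 <= L ^+ 2 * t ^+ 2.
  by rewrite ler_piMr// mulr_ge0// exprn_ge0.
have B6 := ler_wpM2l t0 SS.
lra.
Qed.

(** Counterpart of the lower step. [b0 + Rp * (1 - w0) = L] says that an arrival at an idle queue
    either joins or is lost. In the cell next to 0 a fraction of order [L * t] is given up, but its
    mass is itself at most [L * t]. *)
Lemma volterra_step_upper : 0 <= b0 -> 0 <= w0 <= 1 -> b0 + Rp * (1 - w0) = L ->
  (e + t * (e * (b0 * (1 - g k) + Rp * (1 - w0)))) * (1 - U 0%N) +
  (e * (U 0%N - U 1%N) +
  \sum_(j < k) (e' + t * (e * (Rp * (1 - U j ^+ n * g (k - j.+1)%N)))) * (U j.+1 - U j.+2))
    <= 1 - U k ->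
  U k - U k.+1 <= lambda * t * (conv_sum g x k.+1 - conv_sum g x k) +
    t ^+ 2 * (3 * L ^+ 2 + 4 * lambda * n.+1%:R ^+ 2 * L ^+ 2 * (k%:R * t)).
Proof.
move=> b00 /andP[w00 w01] b0L; rewrite conv_sumS.
set S := \sum_(j < k) _; set S' := \sum_(j < k.+1) _ => H.
have dU j : 0 <= U j - U j.+1 by rewrite subr_ge0.
have Ug i j : 0 <= U i ^+ n * g j <= 1.
  by rewrite mulr_ge0 ?exprn_ge0//= mulr_ile1 ?exprn_ge0// exprn_ile1.
pose D : R := n.+1%:R ^+ 2 * (L ^+ 2 * t ^+ 2).
have D0 : 0 <= D by rewrite !mulr_ge0// exprn_ge0.
pose W := \sum_(j < k) U j ^+ n * g (k - j.+1)%N * (U j.+1 - U j.+2).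
have RW : Rp * W <= lambda * S' + 4 * lambda * D * k%:R.
  have -> : Rp * W = lambda * \sum_(j < k)
      g (k - j.+1)%N * pi0 * (n.+1%:R * U j ^+ n * (U j.+1 - U j.+2)).
    by rewrite RpE /W !mulr_sumr; apply: eq_bigr => j _; ring.
  have -> : lambda * S' + 4 * lambda * D * k%:R = lambda * (S' + \sum_(j < k) 4 * D).
    by rewrite sumr_const card_ord -(mulr_natr (4 * D)); ring.
  (* The first summand of [S'] has no counterpart in [W] and is dropped, being nonnegative. *)
  rewrite ler_wpM2l// /S' big_ord_recl /= -addrA ler_wpDl ?mulr_ge0 ?subr_ge0//.
  rewrite -big_split/=; apply: ler_sum => j _.
  rewrite /bump/= add1n.
  set gj := g _; have gj0 : 0 <= gj by exact: g0.
  have gj1 : gj <= 1 by exact: g1.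
  have := @subrX_ge_error R n (U j.+1) (U j.+2) (U j).
  rewrite U0 U_nincr => /(_ isT (U_nincr _) (U1 _)) A.
  (* The distance spans two cells, whence the factor 4. *)
  have A2 : (U j - U j.+2) ^+ 2 <= 4 * (L ^+ 2 * t ^+ 2).
    have -> : 4 * (L ^+ 2 * t ^+ 2) = (2 * (L * t)) ^+ 2 by ring.
    rewrite lerXn2r// ?nnegrE ?mulr_ge0//.
      by have := dU j; have := dU j.+1; lra.
    by have := U_lip j; have := U_lip j.+1; lra.
  have A3 := ler_wpM2l (exprn_ge0 2 n0) A2.
  apply: (@le_trans _ _ (gj * pi0 * (U j.+1 ^+ n.+1 - U j.+2 ^+ n.+1 + 4 * D))).
    by rewrite ler_wpM2l ?mulr_ge0//; rewrite /D; lra.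
  rewrite mulrDr; apply: lerD; first by rewrite /x -mulrBr mulrA.
  by rewrite ler_piMl ?mulr_ge0// mulr_ile1.
have SW : (1 - Rp * L * t ^+ 2) * (U 1%N - U k.+1) - t * (Rp * W) <= S.
  rewrite -(telescope_ord (fun j => U j.+1)) !mulr_sumr -sumrB.
  apply: ler_sum => j _.
  have := Ug j (k - j.+1)%N; set y := _ * g _ => /andP[y0 y1].
  have := ler_wpM2l (mulr_ge0 t0 (mulr_ge0 Rp0 (y := 1 - y) _)) e_ge.
  rewrite subr_ge0 => /(_ y1) A.
  have B : Rp * (1 - y) * (L * t ^+ 2) <= Rp * (L * t ^+ 2).
    by rewrite ler_wpM2r ?mulr_ge0 ?exprn_ge0// ler_piMr//; lra.
  have C : 1 - Rp * L * t ^+ 2 - t * (Rp * y) <= e' + t * (e * (Rp * (1 - y))).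
    by have := e'_ge; lra.
  by have := ler_wpM2r (dU j.+1) C; lra.
have B1 : (1 - L ^+ 2 * t ^+ 2) * (1 - U 0%N) - t * (lambda * (1 - x 0%N) * g k) <=
   (e + t * (e * (b0 * (1 - g k) + Rp * (1 - w0)))) * (1 - U 0%N).
  rewrite -b0E.
  have -> : b0 * (1 - g k) + Rp * (1 - w0) = L - b0 * g k by rewrite -b0L; ring.
  have bg : b0 * g k <= L.
    apply: (@le_trans _ _ b0); first by rewrite ler_piMr.
    by rewrite -b0L lerDl mulr_ge0// subr_ge0.
  have bg0 : 0 <= b0 * g k by rewrite mulr_ge0.
  have K0 : 0 <= 1 + t * (L - b0 * g k) by rewrite addr_ge0// mulr_ge0// subr_ge0.
  have A := ler_wpM2r K0 e_ge.
  have B : 0 <= L * t * t * (b0 * g k) by rewrite !mulr_ge0.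
  have C : 1 - L ^+ 2 * t ^+ 2 - t * (b0 * g k) <= e + t * (e * (L - b0 * g k)) by lra.
  have p0 : 0 <= 1 - U 0%N by rewrite subr_ge0.
  by have := ler_wpM2r p0 C; lra.
have B2 : (1 - L * t) * (U 0%N - U 1%N) <= e * (U 0%N - U 1%N) by rewrite ler_wpM2r.
have B3 : L * t * (U 0%N - U 1%N) <= L * t * (L * t) by rewrite ler_wpM2l// mulr_ge0.
have Lt0 : 0 <= L ^+ 2 * t ^+ 2 by rewrite mulr_ge0// exprn_ge0.
have B4 : L ^+ 2 * t ^+ 2 * (1 - U 0%N) <= L ^+ 2 * t ^+ 2.
  by rewrite ler_piMr// lerBlDr lerDl.
have B5 : Rp * L * t ^+ 2 * (U 1%N - U k.+1) <= L ^+ 2 * t ^+ 2.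
  apply: (@le_trans _ _ (Rp * L * t ^+ 2)).
    by rewrite ler_piMr ?mulr_ge0 ?exprn_ge0//; have := U1 1%N; have := U0 k.+1; lra.
  by rewrite ler_wpM2r ?exprn_ge0// expr2 ler_wpM2r.
have B6 := ler_wpM2l t0 RW.
rewrite /D in B6; lra.
Qed.

End volterra_step.

(** * Uniqueness of solutions *)

Section volterra_uniqueness.
Context {R : realType}.

(** The one-step errors add up to [c * (K t) * t]. Replacing [g \o S] by [g] in the lower bound
    costs at most [g 0 - g K <= 1], weighted by [lambda * t]. *)
Lemma volterra_telescope (lambda t c : R) (U g x : nat -> R) K :
  0 <= lambda -> 0 <= t ->
  (forall j, 0 <= g j <= 1) -> (forall j, g j.+1 <= g j) -> (forall j, 0 <= x j <= 1) ->
  (forall k, (k < K)%N ->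
    lambda * t * (conv_sum (g \o S) x k.+1 - conv_sum (g \o S) x k) - t ^+ 2 * c
      <= U k - U k.+1) ->
  (forall k, (k < K)%N ->
    U k - U k.+1 <= lambda * t * (conv_sum g x k.+1 - conv_sum g x k) + t ^+ 2 * c) ->
  `|U 0%N - U K - lambda * t * conv_sum g x K| <= (c * (K%:R * t) + lambda) * t.
Proof.
move=> lambda0 t0 g01 gd x01 lo up.
have V0 f : conv_sum f x 0 = 0 by rewrite /conv_sum big_ord0.
have Lo : lambda * t * conv_sum (g \o S) x K - t ^+ 2 * c * K%:R <= U 0%N - U K.
  elim: K lo {up} => [|K IH] lo; first by rewrite V0 !mulr0 !subrr.
  have := IH (fun k kK => lo k (ltnW kK)); have := lo K (ltnSn K).
  rewrite -natr1; lra.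
have Up : U 0%N - U K <= lambda * t * conv_sum g x K + t ^+ 2 * c * K%:R.
  elim: K up {lo Lo} => [|K IH] up; first by rewrite V0 !mulr0 subrr addr0.
  have := IH (fun k kK => up k (ltnW kK)); have := up K (ltnSn K).
  rewrite -natr1; lra.
have VV : conv_sum g x K - conv_sum (g \o S) x K <= 1.
  rewrite /conv_sum -sumrB; apply: (@le_trans _ _ (\sum_(i < K) (g i - g i.+1))).
    apply: ler_sum => i _; rewrite /= -mulrBl ler_piMr ?subr_ge0//.
    by have /andP[] := x01 (K - i)%N; lra.
  by rewrite telescope_ord; have /andP[] := g01 0%N; have /andP[] := g01 K; lra.
have VVl := ler_wpM2l (mulr_ge0 lambda0 t0) VV.
have lt0 : 0 <= lambda * t by rewrite mulr_ge0.
by rewrite ler_norml; apply/andP; split; lra.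
Qed.

(* Discrete form of h(0) - h(w) = lambda \int_0^w H(x) (1 - h(w - x)^d) dx. *)
Definition approx_volterra (H : R -> R) (lambda : R) (d : nat) (h : R -> R) :=
  forall T : R, exists2 C : R, 0 <= C & forall (t : R) (k : nat),
    0 < t -> k%:R * t <= T ->
    `|h 0 - h (k%:R * t) -
      lambda * t * conv_sum (fun i => H (i%:R * t)) (fun j => h (j%:R * t) ^+ d) k|
    <= C * t.

(** Lets the mesh tend to 0: errors proportional to [1 / K] vanish. *)
Lemma le_add_div_nat (a b c : R) : 0 <= c ->
  (forall K : nat, (0 < K)%N -> a <= b + c / K%:R) -> a <= b.
Proof.
move=> c0 H; apply/ler_addgt0Pr => e e0.
have [K K0 cK] : exists2 K : nat, (0 < K)%N & c / e <= K%:R.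
  by exists (Num.truncn (c / e)).+1 => //; rewrite ltW// truncnS_gt.
apply: le_trans (H K K0) _; rewrite lerD2l ler_pdivrMr ?ltr0n//.
by rewrite mulrC -ler_pdivrMr.
Qed.

Section unique.
Variables (H : R -> R) (lambda m : R) (d : nat).
Hypotheses (lambda0 : 0 <= lambda) (d0 : (0 < d)%N).
Hypothesis H01 : forall x, 0 <= H x <= 1.
Hypothesis H_sum : forall (t : R) (K : nat), 0 < t ->
  t * \sum_(i < K) H (i%:R * t) <= m + t.

Section initial.
Variables h h' : R -> R.
Hypotheses (h01 : forall x, 0 <= h x <= 1) (h'01 : forall x, 0 <= h' x <= 1).
Hypotheses (h_nincr : forall x y, x <= y -> h y <= h x).
Hypotheses (h'_nincr : forall x y, x <= y -> h' y <= h' x).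
Hypothesis h_cvg0 : forall e, 0 < e -> exists2 k : nat, (0 < k)%N & h k%:R < e.
Hypothesis h'_cvg0 : forall e, 0 < e -> exists2 k : nat, (0 < k)%N & h' k%:R < e.
Hypotheses (hV : approx_volterra H lambda d h) (h'V : approx_volterra H lambda d h').

(* Letting w -> +oo in the equation, both initial values are
   lambda \int_0^oo H. *)
Lemma volterra_initial_le : h 0 <= h' 0.
Proof.
have m0 : 0 <= m + 1.
  by have := H_sum 0 ltr01; rewrite big_ord0 mulr0.
have E0 : 0 < 1 + lambda * (m + 1) by rewrite ltr_pwDl// mulr_ge0.
suff K e : 0 < e -> h 0 <= h' 0 + e * (1 + lambda * (m + 1)).
  apply/ler_addgt0Pr => e e0; apply: le_trans (K (e / (1 + lambda * (m + 1))) _) _.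
    by rewrite divr_gt0.
  by rewrite divfK// gt_eqF.
move=> e0; have [k1 k10 hk1] := h_cvg0 e0; have [k2 k20 hk2] := h'_cvg0 e0.
(* From this horizon on, both functions are at most [e]. *)
pose T : R := (maxn k1 k2)%:R.
have T0 : 0 < T by rewrite ltr0n leq_max k10.
have hT : h T <= e by apply: le_trans (ltW hk1); apply: h_nincr; rewrite ler_nat leq_maxl.
have h'T : h' T <= e by apply: le_trans (ltW hk2); apply: h'_nincr; rewrite ler_nat leq_maxr.
have [C C0 hC] := hV T; have [C' C'0 h'C] := h'V (2 * T).
(* The summand [e * lambda] accounts for the extra [t] in [H_sum]. *)
apply: (@le_add_div_nat _ _ (T * (C + C' + e * lambda))).
  by rewrite mulr_ge0 ?addr_ge0 ?mulr_ge0// ltW.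
move=> K K0; pose t := T / K%:R.
have KR : 0 < K%:R :> R by rewrite ltr0n.
have t0 : 0 < t by rewrite divr_gt0.
have Kt : K%:R * t = T by rewrite mulrC divfK// gt_eqF.
have K2t : (2 * K)%:R * t = 2 * T by rewrite natrM -mulrA Kt.
have := hC t K t0; have := h'C t (2 * K)%N t0; rewrite Kt K2t.
move=> /(_ (lexx _)) + /(_ (lexx _)); rewrite !ler_norml => /andP[A _] /andP[_ B].
set I := t * \sum_(i < K) H (i%:R * t).
have I0 : 0 <= I.
  by rewrite mulr_ge0 ?(ltW t0)//; apply: sumr_ge0 => i _; have /andP[] := H01 (i%:R * t).
have Im : I <= m + t by exact: H_sum.
have V1 : t * conv_sum (fun i => H (i%:R * t)) (fun j => h (j%:R * t) ^+ d) K <= I.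
  rewrite ler_wpM2l ?(ltW t0)//; apply: ler_sum => i _.
  have /andP[Hi _] := H01 (i%:R * t); rewrite ler_piMr// lerBlDr lerDl exprn_ge0//.
  by have /andP[] := h01 ((K - i)%:R * t).
(* Only the first half of the range [2 * T] is kept: there the argument of [h'] is at least [T], so
   [h' ^+ d <= h' <= e]. *)
have V2 : I * (1 - e) <= t * conv_sum (fun i => H (i%:R * t)) (fun j => h' (j%:R * t) ^+ d) (2 * K).
  rewrite /I -mulrA ler_wpM2l ?(ltW t0)// /conv_sum mul2n -addnn big_split_ord /=.
  rewrite -[leLHS]addr0; apply: lerD; last first.
    apply: sumr_ge0 => i _; apply: mulr_ge0; first by have /andP[] := H01 ((K + i)%:R * t).
    have /andP[z0 z1] := h'01 ((K + K - (K + i))%:R * t).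
    by rewrite subr_ge0 exprn_ile1.
  rewrite mulr_suml; apply: ler_sum => i _; have /andP[Hi _] := H01 (i%:R * t).
  rewrite ler_wpM2l// lerD2l lerN2.
  have /andP[z0 z1] := h'01 ((K + K - i)%:R * t).
  apply: le_trans (_ : h' ((K + K - i)%:R * t) <= _).
    by rewrite -[leRHS]expr1; apply: ler_wiXn2l.
  apply: le_trans h'T; apply: h'_nincr; rewrite -Kt ler_wpM2r ?(ltW t0)// ler_nat.
  by rewrite -addnBA ?leq_addr// ltnW.
have V1l := ler_wpM2l lambda0 V1; have V2l := ler_wpM2l lambda0 V2.
have h'2 : 0 <= h' (2 * T) by have /andP[] := h'01 (2 * T).
have Ime := ler_wpM2l (mulr_ge0 lambda0 (ltW e0)) Im.
have l1 : 0 <= lambda * e by rewrite mulr_ge0// ltW.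
have -> : T * (C + C' + e * lambda) / K%:R = t * (C + C' + e * lambda).
  by rewrite /t; ring.
move: hT A B V1l V2l Ime.
set a := conv_sum _ _ _; set b := conv_sum _ _ _.
lra.
Qed.
End initial.

Variables h h' : R -> R.
Hypotheses (h01 : forall x, 0 <= h x <= 1) (h'01 : forall x, 0 <= h' x <= 1).
Hypotheses (h_nincr : forall x y, x <= y -> h y <= h x).
Hypotheses (h'_nincr : forall x y, x <= y -> h' y <= h' x).
Hypothesis h_cvg0 : forall e, 0 < e -> exists2 k : nat, (0 < k)%N & h k%:R < e.
Hypothesis h'_cvg0 : forall e, 0 < e -> exists2 k : nat, (0 < k)%N & h' k%:R < e.
Hypotheses (hV : approx_volterra H lambda d h) (h'V : approx_volterra H lambda d h').

(** The initial values agree, so subtracting the equations bounds the difference by a multiple of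
    its sum over earlier grid points plus the mesh error. *)
Lemma volterra_unique w : 0 <= w -> h w = h' w.
Proof.
have h00 : h 0 = h' 0.
  by apply: le_anti; rewrite !volterra_initial_le.
rewrite le_eqVlt => /orP[/eqP<-//|w0].
have [C C0 hC] := hV w; have [C' C'0 h'C] := h'V w.
apply/eqP; rewrite -subr_eq0 -normr_le0.
set A := lambda * d%:R; have A0 : 0 <= A by rewrite mulr_ge0.
apply: (@le_add_div_nat _ _ (w * ((A + C + C') * expR (A * w)))).
  by rewrite !mulr_ge0 ?addr_ge0 ?expR_ge0// ltW.
move=> K K0; pose t := w / K%:R.
have KR : 0 < K%:R :> R by rewrite ltr0n.
have t0 : 0 < t by rewrite divr_gt0.
have Kt : K%:R * t = w by rewrite mulrC divfK// gt_eqF.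
pose delta k := `|h (k%:R * t) - h' (k%:R * t)|.
have At0 : 0 <= A * t by rewrite mulr_ge0// ltW.
have G k : (k <= K)%N -> delta k <= (A * t) * \sum_(j < k) delta j + (A + C + C') * t.
  move=> kK; have kw : k%:R * t <= w.
    by rewrite -Kt ler_wpM2r ?(ltW t0)// ler_nat.
  have := hC t k t0 kw; have := h'C t k t0 kw; rewrite /delta.
  set x := h (k%:R * t); set x' := h' (k%:R * t).
  set V := conv_sum _ _ _; set V' := conv_sum _ _ _.
  (* The convolution also involves the current point [k]; this crude bound moves its term into the
     error of order [t]. *)
  have dk1 : delta k <= 1.
    rewrite /delta ler_norml; have /andP[? ?] := h01 (k%:R * t).
    by have /andP[? ?] := h'01 (k%:R * t); apply/andP; split; lra.
  have VV : `|V' - V| <= d%:R * (\sum_(j < k) delta j + 1).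
    rewrite /V /V' /conv_sum -sumrB.
    apply: le_trans (ler_norm_sum _ _ _) _.
    apply: (@le_trans _ _ (\sum_(i < k) d%:R * delta (k - i)%N)).
      apply: ler_sum => i _.
      have /andP[Hi0 Hi1] := H01 (i%:R * t).
      rewrite -mulrBr normrM (ger0_norm Hi0).
      have -> : 1 - h ((k - i)%:R * t) ^+ d - (1 - h' ((k - i)%:R * t) ^+ d) =
        - (h ((k - i)%:R * t) ^+ d - h' ((k - i)%:R * t) ^+ d) by ring.
      rewrite normrN; apply: le_trans (distrX_le _ (h01 _) (h'01 _)).
      by rewrite ler_piMl.
    rewrite -mulr_sumr ler_wpM2l//.
    have -> : \sum_(i < k) delta (k - i)%N = \sum_(i < k) delta i.+1.
      rewrite (reindex_inj rev_ord_inj)/=; apply: eq_bigr => i _.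
      by rewrite subKn.
    have E : \sum_(i < k.+1) delta i = delta 0%N + \sum_(i < k) delta i.+1.
      by rewrite big_ord_recl.
    have : 0 <= delta 0%N by exact: normr_ge0.
    by move: E dk1; rewrite big_ord_recr/=; lra.
  have := ler_wpM2l (mulr_ge0 lambda0 (ltW t0)) VV.
  have : `|lambda * t * (V' - V)| <= lambda * t * `|V' - V|.
    by rewrite normrM ger0_norm// mulr_ge0// ltW.
  rewrite !ler_norml /A => /andP[a1 a2] a3 /andP[a4 a5] /andP[a6 a7].
  by apply/andP; split; lra.
have := discrete_gronwall At0 G (leqnn K); rewrite /delta Kt add0r => D.
apply: le_trans D _; have -> : w * ((A + C + C') * expR (A * w)) / K%:R =
    (A + C + C') * t * expR (A * w) by rewrite /t; ring.
rewrite ler_wpM2l//; first by rewrite mulr_ge0 ?addr_ge0// ltW.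
(* The Gronwall factor [(1 + A * t) ^+ K] is at most [expR (A * w)], uniformly in [K]. *)
have -> : A * w = K%:R * (A * t) by rewrite -Kt; ring.
rewrite expRM_natl lerXn2r ?nnegrE ?expR_ge0//; first by rewrite addr_ge0.
exact: expR_ge1Dx.
Qed.
End unique.
End volterra_uniqueness.

(** * Equilibrium and response time *)

Section equilibrium_volterra.
Context {R : realType}.
Variables (d : nat) (G : law R) (lambda pi0 : R) (mu : law R).
Hypotheses (lambda0 : 0 <= lambda) (pi0_ge0 : 0 <= pi0) (pi0_le1 : pi0 <= 1).
Hypothesis d0 : (0 < d)%N.
Hypothesis G_pos : ccdf G 0 = 1.
Hypothesis mu_eq : equilibrium d G lambda pi0 mu.

Local Notation Rp := (potential_rate d lambda pi0).
Local Notation Rm := (memory_rate lambda pi0 mu 0).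
Local Notation win v := (win_avg (fine (mu [set v])) (ccdf mu v) d.-1 0).
Local Notation u := (ccdf mu).
Local Notation H := (ccdf G).

Lemma density_atomless (f : R -> R) v : density_on_pos mu f -> 0 < v -> mu [set v] = 0%E.
Proof.
move=> [_ _ fE] v0; rewrite fE//.
- exact: integral_set1.
- by move=> x ->; rewrite /= in_itv/= v0.
Qed.

(** An arrival goes to an idle queue unless the memory is empty and all [d] sampled queues are busy.
    Potential arrivals contribute [lambda * pi0 * (1 - u 0 ^+ d)], by [win_avg_tie], and the memory
    [lambda * (1 - pi0)]. *)
Lemma idle_join_rate :
  (Rp * win 0 + Rm) * (1 - u 0) = lambda * (1 - pi0 * u 0 ^+ d).
Proof.
have [mu_neg mu0 _ _] := mu_eq.
have pE : fine (mu [set 0]) = 1 - u 0 by rewrite ccdf_atom0.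
have p0 : 1 - u 0 != 0.
  by move: mu0; rewrite ccdf_atom0// lte_fin => /gt_eqF ->.
have W := @win_avg_tie R (1 - u 0) (u 0) d.-1 (subrK _ _).
rewrite prednK// in W; rewrite mulrDl pE /potential_rate /memory_rate eqxx divfK//.
have -> : lambda * d%:R * pi0 * win_avg (1 - u 0) (u 0) d.-1 0 * (1 - u 0) =
  lambda * pi0 * ((1 - u 0) * d%:R * win_avg (1 - u 0) (u 0) d.-1 0) by ring.
by rewrite W; ring.
Qed.

(** Multiplying the equation for [u] by [a] turns [pi0 * u ^+ d] into a power of the solution
    [a * u] itself. The system without memory is the case [a = 1]. *)
Lemma equilibrium_approx_volterra (a : R) : 0 <= a <= 1 -> a ^+ d = pi0 ->
  approx_volterra H (lambda * a) d (fun w => a * u w).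
Proof.
move=> /andP[a0 a1] ad T.
have [mu_neg mu0 [f /density_atomless mu_atomless] mu_stat] := mu_eq.
set n := d.-1; have dn : d = n.+1 by rewrite prednK.
have Rp0 : 0 <= Rp by exact: potential_rate_ge0.
have Rm0 : 0 <= Rm by exact: memory_rate_ge0.
have w01 := win01 d mu 0.
set L := Rp + Rm; have L0 : 0 <= L by rewrite addr_ge0.
pose D : R := lambda * d%:R ^+ 2 * L ^+ 2; have D0 : 0 <= D by rewrite !mulr_ge0 ?exprn_ge0.
(* Dominates the error constants of both one-step bounds up to [T]; the absolute value keeps it
   nonnegative for every [T]. *)
pose c : R := 3 * L ^+ 2 + L * lambda + 4 * D * `|T|.
have c0 : 0 <= c by rewrite !addr_ge0 ?mulr_ge0 ?exprn_ge0.
exists (c * `|T| + lambda) => [|t K t0 KT]; first by rewrite addr_ge0 ?mulr_ge0.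
have t0' := ltW t0.
have KT' : K%:R * t <= `|T| := le_trans KT (ler_norm T).
pose U j := u (j%:R * t); pose g j := H (j%:R * t); pose x j := pi0 * U j ^+ d.
have U0 j : 0 <= U j := ccdf_ge0 _ _.
have U1 j : U j <= 1 := ccdf_le1 _ _.
have g0 j : 0 <= g j := ccdf_ge0 _ _.
have g1 j : g j <= 1 := ccdf_le1 _ _.
have Sle (j : nat) : j%:R * t <= j.+1%:R * t by rewrite ler_wpM2r// ler_nat.
have U_nincr j : U j.+1 <= U j by exact: ccdf_nincr.
have U_lip j : U j - U j.+1 <= L * t.
  rewrite /U grid_succ.
  exact: (ccdf_lipschitz lambda0 pi0_ge0 pi0_le1 mu_neg mu_stat (mulr_ge0 (ler0n _ _) t0') t0').
pose e := expR (- (L * t)); pose e' := expR (- (Rp * t)).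
have e_ge : 1 - L * t <= e by exact: expR_ge_sub.
have e'_ge : 1 - Rp * t <= e' by exact: expR_ge_sub.
have RpL : Rp <= L by rewrite lerDl.
have RpE : Rp = lambda * n.+1%:R * pi0 by rewrite -dn.
have b0E : (Rp * win 0 + Rm) * (1 - U 0%N) = lambda * (1 - pi0 * U 0%N ^+ n.+1).
  by rewrite /U mul0r -dn idle_join_rate.
have kK (k : nat) : (k < K)%N -> k.+1%:R * t <= `|T|.
  by move=> kK; apply: le_trans KT'; rewrite ler_wpM2r// ler_nat.
have xE : x = (fun j => pi0 * U j ^+ n.+1) by rewrite /x dn.
have := @volterra_telescope R lambda t c U g x K lambda0 t0'.
have /[swap]/[apply] : forall j, 0 <= g j <= 1 by move=> j; rewrite g0 g1.
have /[swap]/[apply] : forall j, g j.+1 <= g j by move=> j; exact: ccdf_nincr.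
have /[swap]/[apply] : forall j, 0 <= x j <= 1.
  by move=> j; rewrite mulr_ge0 ?exprn_ge0//= mulr_ile1 ?exprn_ge0// exprn_ile1.
move=> tel; have {}tel : `|U 0%N - U K - lambda * t * conv_sum g x K| <=
    (c * (K%:R * t) + lambda) * t.
  apply: tel => k /kK kT.
  - have S := ccdf_step_lower lambda0 pi0_ge0 pi0_le1 G_pos mu_neg mu_stat k t0 erefl.
    have := @volterra_step_lower R n lambda pi0 L Rp (Rp * win 0 + Rm) t e e' U g k.
    rewrite -xE => B; apply: le_trans (B _ _ _ _ _ _ _ _ _ _ _ _ _ _ _ _ _) => //.
    + rewrite lerD2l lerN2 ler_wpM2l ?exprn_ge0//.
      have : D * (k.+1%:R * t) <= D * `|T| by rewrite ler_wpM2l.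
      have : 0 <= D * `|T| by rewrite mulr_ge0.
      have : 0 <= L ^+ 2 by rewrite exprn_ge0.
      by rewrite /c /D dn; lra.
    + by move: S; rewrite {1}/U mul0r.
  - have S := ccdf_step_upper lambda0 pi0_ge0 pi0_le1 G_pos mu_neg mu_atomless mu_stat k t0 erefl.
    have := @volterra_step_upper R n lambda pi0 L Rp (Rp * win 0 + Rm) (win 0) t e e' U g k.
    rewrite -xE => B; apply: le_trans (B _ _ _ _ _ _ _ _ _ _ _ _ _ _ _ _ _ _ _ _) _ => //.
    + by rewrite addr_ge0 ?mulr_ge0//; case/andP: w01.
    + by rewrite /L; ring.
    + by move: S; rewrite /U !mul0r mul1r.
    + rewrite lerD2l ler_wpM2l ?exprn_ge0//.
      have : D * (k%:R * t) <= D * `|T|.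
        by rewrite ler_wpM2l// (le_trans _ kT).
      have : 0 <= L * lambda by rewrite mulr_ge0.
      by rewrite /c /D dn; lra.
have {}tel : `|U 0%N - U K - lambda * t * conv_sum g x K| <= (c * `|T| + lambda) * t.
  by apply: le_trans tel _; rewrite ler_wpM2r// lerD2r ler_wpM2l.
apply: le_trans tel.
have -> : (fun j : nat => (a * u (j%:R * t)) ^+ d) = x.
  by apply/funext => j; rewrite exprMn ad.
rewrite -/g -/(U K) /U mul0r -/(U K).
have -> : a * u 0 - a * U K - lambda * a * t * conv_sum g x K =
  a * (u 0 - U K - lambda * t * conv_sum g x K) by ring.
by rewrite normrM (ger0_norm a0) ler_piMl.
Qed.

End equilibrium_volterra.

(** * Mean job size and Riemann sums of the ccdf *)

Section job_size.
Context {R : realType}.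
Variables (G : law R).
Hypothesis G_pos : G `]0, +oo[%classic = 1%E.
Local Notation H := (ccdf G).

Lemma expectation_pos : ('E_G[idfun] = \int[G]_(x in `]0%R, +oo[) x%:E)%E.
Proof.
rewrite unlock [RHS]integral_mkcond; apply: ae_eq_integral => //.
- by apply/measurable_EFinP; exact: measurable_id.
- apply/(measurable_restrictT _ _).1 => //.
- exists `]-oo, 0]%classic; split => //.
    by have := ccdf_itvNyc G 0; rewrite /Defs.ccdf G_pos subrr.
  move=> x; apply: contra_notP => /=; rewrite in_itv/= => /negP; rewrite -ltNge => x0 _.
  by rewrite patchE mem_set//= in_itv/= x0.
Qed.

(** Apart from the summand at 0, which yields the extra [t], this is a right Riemann sum of a
    nonincreasing function whose integral is the mean; it is the expectation of a step function
    below the identity. *)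
Lemma ccdf_sum_le (m t : R) (K : nat) : ('E_G[idfun] = m%:E)%E -> 0 < t ->
  t * \sum_(i < K) H (i%:R * t) <= m + t.
Proof.
move=> mE t0.
(* The second bound carries the induction: if [x] lies beyond the next grid point, [N * t] leaves
   room for one more [t]. *)
have S x N : 0 < x -> let s := \sum_(i < N) t * \1_(`]i.+1%:R * t, +oo[%classic : set R) x in
    s <= x /\ s <= N%:R * t.
  move=> x0 /=; elim: N => [|N [IH1 IH2]].
    by rewrite big_ord0 mul0r lexx ltW.
  rewrite big_ord_recr/= indicE.
  have -> : (x \in (`]N.+1%:R * t, +oo[%classic : set R)) = (N.+1%:R * t < x).
    by apply/idP/idP; rewrite inE/= in_itv/= andbT.
  rewrite grid_succ; case: ltP => h; rewrite ?mulr1 ?mulr0; lra.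
have I N : \sum_(i < N) t * H (i.+1%:R * t) <= m.
  rewrite -lee_fin -mE expectation_pos.
  have := @integral_ge_sum_indic _ _ _ G `]0, +oo[%classic (EFin \o idfun) N (fun=> t)
    (fun i => `]i.+1%:R * t, +oo[%classic) (measurable_itv _).
  move=> B; apply: le_trans (B _ _ _) => //.
  - rewrite -sumEFin; apply: lee_sum => i _.
    rewrite setIidl; first by rewrite EFinM -ccdfE.
    by move=> x; rewrite /= !in_itv/= !andbT; apply: le_lt_trans; rewrite mulr_ge0// ltW.
  - by move=> i _; exact: ltW.
  - by move=> x /=; rewrite in_itv/= andbT => x0; rewrite lee_fin; case: (S x N x0).
case: K => [|K].
  rewrite big_ord0 mulr0 addr_ge0 ?(ltW t0)//.
  by have := I 0%N; rewrite big_ord0.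
rewrite big_ord_recl/= mulrDr addrC lerD//.
  by rewrite mulr_sumr; apply: le_trans (I K).
by rewrite ler_piMr ?ccdf_le1// (ltW t0).
Qed.

End job_size.

(** * Law of the minimum of independent workloads *)

Section minimum_law.
Context {R : realType}.
Implicit Types mu M : law R.

Lemma eq_iid_expectation mu n (h h' : seq R -> \bar R) :
  (forall us, size us = n -> h us = h' us) ->
  iid_expectation mu n h = iid_expectation mu n h'.
Proof.
elim: n h h' => [|n IH] h h' hh /=; first exact: hh.
by apply: eq_integral => x _; apply: IH => us us_n; apply: hh; rewrite /= us_n.
Qed.

(** The fold in [min_load] starts from the head of the list, so prepending [u] changes this default;
    [K] exchanges the default with another element and [K'] absorbs a repeated one. *)
Lemma min_loadE (u : R) us : us != [::] -> min_load (u :: us) = Num.min u (min_load us).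
Proof.
case: us => // v us _; rewrite /min_load /= !big_cons.
have K (s : seq R) (a b : R) :
    Num.min a (\big[Num.min/b]_(w <- s) w) = Num.min b (\big[Num.min/a]_(w <- s) w).
  elim: s => [|x s IH]; first by rewrite !big_nil minC.
  by rewrite !big_cons minCA IH minCA.
have K' (s : seq R) (a : R) : Num.min a (\big[Num.min/a]_(w <- s) w) = \big[Num.min/a]_(w <- s) w.
  by elim: s => [|x s IH]; rewrite ?big_nil ?minxx// !big_cons minCA IH.
by rewrite K minA minxx K'.
Qed.

Lemma measurable_minr2 :
  measurable_fun setT (fun z : measurableTypeR R * measurableTypeR R => Num.min z.1 z.2 : measurableTypeR R).
Proof. by apply: measurable_minr; [exact: measurable_fst|exact: measurable_snd]. Qed.

(** [M] is built by induction as the image under [Num.min] of the product of [mu] and the previous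
    law. Tonelli's theorem identifies the iterated integral, and independence makes the tails
    multiply. *)
Lemma iid_expectation_min mu n : exists M : law R,
  (forall h : measurableTypeR R -> \bar R, measurable_fun setT h -> (forall x, 0 <= h x)%E ->
    iid_expectation mu n.+1 (fun us => h (min_load us)) = \int[M]_x h x)%E /\
  forall w, M `]w, +oo[%classic = (ccdf mu w ^+ n.+1)%:E.
Proof.
elim: n => [|n [M [IH1 IH2]]].
  exists mu; split => [h _ _ /=|w]; last by rewrite expr1 ccdfE.
  by apply: eq_integral => x _; rewrite /min_load big_cons big_nil /= minxx.
pose X : {mfun (measurableTypeR R * measurableTypeR R)%type >-> measurableTypeR R} :=
  HB.pack (fun z : measurableTypeR R * measurableTypeR R => Num.min z.1 z.2 : measurableTypeR R)
    (isMeasurableFun.Build _ _ _ _ _ measurable_minr2).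
exists (distribution (mu \x M)%E X); split => [h mh h0|w].
  transitivity (\int[mu]_u iid_expectation mu n.+1 (fun us => h (min_load (u :: us))))%E => //.
  rewrite (ge0_integral_pushforward measurable_minr2)// preimage_setT.
  rewrite fubini_tonelli1; last 2 first.
  - exact: (measurableT_comp mh measurable_minr2).
  - by move=> x; exact: h0.
  apply: eq_integral => u _.
  rewrite (@eq_iid_expectation mu n.+1 _ (fun us => h (Num.min u (min_load us)))).
    rewrite (IH1 (fun x => h (Num.min u x)))//.
    apply: measurableT_comp => //; apply: measurable_minr => //.
  by move=> us us_n; rewrite min_loadE//; case: us us_n.
rewrite /distribution /pushforward.
transitivity ((mu \x M)%E (`]w, +oo[%classic `*` `]w, +oo[%classic)).
  congr (product_measure1 _ _ _); rewrite eqEsubset; split => -[x y] /=; rewrite !in_itv/= !andbT lt_min.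
    by move=> /andP[].
  by move=> [-> ->].
by rewrite exprS EFinM -ccdfE -IH2; apply: product_measure1E; exact: measurable_itv.
Qed.

(** Open upper half-lines are stable under intersection, generate the Borel sets and exhaust the
    line, so finite measures agreeing on them coincide. The Dirac mass stands for jobs sent to an
    idle server. *)
Lemma mixture_dirac0_integral M M' (a b : {nonneg R}) :
  (forall w, a%:num%:E * M `]w, +oo[%classic + b%:num%:E * ((w < 0)%R%:R)%:E =
    M' `]w, +oo[%classic)%E ->
  forall h : measurableTypeR R -> \bar R, measurable_fun setT h -> (forall x, 0 <= h x)%E ->
  (a%:num%:E * \int[M]_x h x + b%:num%:E * h 0%R = \int[M']_x h x)%E.
Proof.
move=> MM' h mh h0.
pose d0 : {measure set (measurableTypeR R) -> \bar R} := @dirac _ (measurableTypeR R) 0 R.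
pose N : {measure set (measurableTypeR R) -> \bar R} := measure_add (mscale a M) (mscale b d0).
have NA A : N A = (a%:num%:E * M A + b%:num%:E * d0 A)%E by exact: measure_addE.
have dE w : d0 `]w, +oo[%classic = ((w < 0)%R%:R)%:E.
  rewrite /d0 /= diracE (_ : (_ \in _) = (w < 0)%R)//.
  by apply/idP/idP; rewrite inE/= in_itv/= andbT.
have NE A : measurable A -> N A = M' A.
  apply: (@measure_unique _ R (measurableTypeR R) (@RGenOInfty.G R)
    (fun n => `]- n%:R, +oo[%classic) _ _ _ _ N M').
  - exact: RGenOInfty.measurableE.
  - move=> _ _ [x ->] [y ->]; exists (Num.max x y).
    rewrite eqEsubset; split => z /=; rewrite !in_itv/= !andbT gt_max.
      by move=> [-> ->].
    by move=> /andP[].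
  - by move=> i; exists (- i%:R).
  - rewrite -subTset => x _; exists (Num.truncn (- x)).+1 => //=.
    by rewrite in_itv/= andbT ltrNl truncnS_gt.
  - by move=> _ [x ->]; rewrite NA dE MM'.
  - move=> k; rewrite NA dE MM' -ge0_fin_numE//.
    by rewrite fin_num_measure//; exact: measurable_itv.
transitivity (\int[N]_x h x)%E; last first.
  by apply: eq_measure_integral => A mA _; exact: NE.
rewrite /N ge0_integral_measure_add// !ge0_integral_mscale// integral_dirac//.
by rewrite diracE mem_set// mul1e.
Qed.

End minimum_law.

(** * Comparison of the two systems *)

Section response.
Context {R : realType}.
Implicit Types G mu : law R.

(** An infinite mean would make the product with [lambda] infinite or 0, whereas [rho] is real and
    positive. *)
Lemma mean_job_size_finite G (lambda rho : R) : G `]0, +oo[%classic = 1%E ->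
  (rho%:E = lambda%:E * 'E_G[idfun])%E -> 0 < rho ->
  0 < lambda /\ exists m : R, ('E_G[idfun] = m%:E)%E.
Proof.
move=> G_pos; rewrite (expectation_pos G_pos).
have : (0 <= \int[G]_(x in `]0%R, +oo[) x%:E)%E.
  by apply: integral_ge0 => x; rewrite /= in_itv/= andbT lee_fin => /ltW.
case: (integral _ _ _) => [m| |]// m0 E rho0.
  split; last by exists m.
  move: E rho0 m0; rewrite -EFinM => -[->]; rewrite lee_fin => lm m0.
  have mp : 0 < m by rewrite lt_neqAle m0 andbT; apply: contraTneq lm => <-; rewrite mulr0 ltxx.
  by rewrite pmulr_lgt0 in lm.
move: E; have [l0|l0|->] := ltgtP lambda 0.
- by rewrite lt0_muley ?lte_fin.
- by rewrite gt0_muley ?lte_fin.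
- by rewrite mul0e => -[rho_eq0]; rewrite rho_eq0 ltxx in rho0.
Qed.

Lemma powR_inv_root (d : nat) (p : R) : (0 < d)%N -> 0 <= p <= 1 ->
  (0 <= p `^ (d%:R^-1) <= 1) /\ (p `^ (d%:R^-1)) ^+ d = p.
Proof.
move=> d0 /andP[p0 p1]; have E : (p `^ (d%:R^-1)) ^+ d = p.
  by rewrite -powR_mulrn ?powR_ge0// -powRrM mulVf ?powRr1// pnatr_eq0 -lt0n.
split=> //; rewrite powR_ge0/= leNgt; apply/negP => a1.
have : 1 < (p `^ (d%:R^-1)) ^+ d by rewrite exprn_egt1// -lt0n.
by rewrite E ltNge p1.
Qed.

Lemma ccdf_lt0 mu w : mu `]-oo, 0[%classic = 0%E -> w < 0 -> ccdf mu w = 1.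
Proof.
move=> mu0 w0; have : (mu `]-oo, w]%classic <= mu `]-oo, 0%R[%classic)%E.
  by apply: le_measure; rewrite ?inE//; move=> x; rewrite /= !in_itv/= => /le_lt_trans; apply.
rewrite mu0 ccdf_itvNyc lee_fin => w1.
by apply: le_anti; rewrite ccdf_le1/=; lra.
Qed.

(** Both sides solve the equation with arrival rate [lambda * a] and vanish at infinity, so
    uniqueness applies. *)
Lemma equilibrium_tail_scaling (d : nat) G (lambda pi0 a m : R) (mu mu' : law R) :
  (0 < d)%N -> G `]0, +oo[%classic = 1%E -> ('E_G[idfun] = m%:E)%E ->
  0 <= lambda -> 0 <= a <= 1 -> a ^+ d = pi0 ->
  equilibrium d G lambda pi0 mu -> equilibrium d G (lambda * a) 1 mu' ->
  forall w, 0 <= w -> a * ccdf mu w = ccdf mu' w.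
Proof.
move=> d0 G_pos mE lambda0 a01 ad mu_eq mu'_eq.
have /andP[a0 a1] := a01.
have G1 : ccdf G 0 = 1 by rewrite /Defs.ccdf G_pos.
have pi0_ge0 : 0 <= pi0 by rewrite -ad exprn_ge0.
have pi0_le1 : pi0 <= 1 by rewrite -ad exprn_ile1.
have la0 : 0 <= lambda * a by rewrite mulr_ge0.
have V := equilibrium_approx_volterra lambda0 pi0_ge0 pi0_le1 d0 G1 mu_eq a01 ad.
have V' : approx_volterra (ccdf G) (lambda * a) d (ccdf mu').
  have := equilibrium_approx_volterra (a := 1) la0 ler01 (lexx 1) d0 G1 mu'_eq _ (expr1n _ d).
  rewrite mulr1 (_ : (fun w => 1 * ccdf mu' w) = ccdf mu'); last first.
    by apply/funext => w; rewrite mul1r.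
  by apply; rewrite ler01 lexx.
have HS (t : R) (K : nat) : 0 < t -> t * \sum_(i < K) ccdf G (i%:R * t) <= m + t.
  exact: ccdf_sum_le.
move=> w w0; apply: (volterra_unique la0 d0 _ HS _ _ _ _ _ _ V V') => //.
- by move=> x; rewrite ccdf_ge0 ccdf_le1.
- by move=> x; rewrite mulr_ge0 ?ccdf_ge0//= mulr_ile1 ?ccdf_ge0 ?ccdf_le1.
- by move=> x; rewrite ccdf_ge0 ccdf_le1.
- by move=> x y xy; rewrite ler_wpM2l// ccdf_nincr.
- exact: ccdf_nincr.
- move=> e e0; have [k k0 ke] := ccdf_lt_eventually mu e0.
  by exists k => //; apply: le_lt_trans ke; rewrite ler_piMl// ccdf_ge0.
- exact: ccdf_lt_eventually.
Qed.

Lemma measurable_shift_law G (A : set (measurableTypeR R)) : measurable A ->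
  measurable_fun (setT : set (measurableTypeR R)) (fun m : measurableTypeR R => G [set x | A (m + x)]).
Proof.
move=> mA; pose S : set (measurableTypeR R * measurableTypeR R) := [set z | A (z.1 + z.2)].
have mS : measurable S.
  rewrite -[S]setTI; apply: measurable_funD => //.
have -> : (fun m : measurableTypeR R => G [set x | A (m + x)]) = G \o xsection S.
  by apply/funext => m /=; congr (G _); rewrite xsectionE.
exact: measurable_fun_xsection.
Qed.

End response.
Arguments powR_inv_root {R} d p.

Unset Implicit Arguments.
Set Strict Implicit.

Theorem theorem6 (R : realType) (d : nat) (hd : (1 <= d)%N)
  (G : law R) (g : R -> R) (hG : job_size_law G g)
  (lambda rho pi0 : R)
  (hrho : (rho%:E = lambda%:E * 'E_G[idfun])%E)
  (hrho01 : 0 < rho < 1) (hpi0 : 0 < pi0 <= 1)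
  (mu mu' : law R)
  (hmu : equilibrium d G lambda pi0 mu)
  (hmu' : equilibrium d G (lambda * pi0 `^ (d%:R^-1)) 1 mu') :
  forall A : set (measurableTypeR R), measurable A ->
    response_law d G pi0 mu A = response_law d G 1 mu' A.
Proof.
move=> A mA; have [G_pos _] := hG.
have /andP[rho0 _] := hrho01; have /andP[pi0_gt0 pi0_le1] := hpi0.
have [/ltW lambda0 [m mE]] := mean_job_size_finite G_pos hrho rho0.
have [a01 ad] := powR_inv_root d pi0 hd (introT andP (conj (ltW pi0_gt0) pi0_le1)).
have tail := equilibrium_tail_scaling hd G_pos mE lambda0 a01 ad hmu hmu'.
have [M [ME Mw]] := iid_expectation_min mu d.-1.
have [M' [M'E M'w]] := iid_expectation_min mu' d.-1.
rewrite prednK// in ME Mw M'E M'w.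
(* The probability that a waiting time [m] plus a job size falls in [A]. *)
pose h m := G [set x | A (m + x)].
have mh := measurable_shift_law G mA.
have h0 x : (0 <= h x)%E by exact: measure_ge0.
rewrite /response_law (ME h mh h0) (M'E h mh h0) subrr mul0e add0e mul1e addeC.
have q0 : 0 <= 1 - pi0 by rewrite subr_ge0.
have -> : G A = h 0.
  by rewrite /h; congr (G _); apply/funext => x /=; rewrite add0r.
(* It remains to compare the tails of the waiting times. The atom at 0 counts only for [w < 0],
   where all tails are 1; for [w >= 0] the scaling of the ccdfs is raised to the power [d]. *)
apply: (mixture_dirac0_integral (a := NngNum (ltW pi0_gt0)) (b := NngNum q0)) => // w /=.
rewrite Mw M'w -!EFinM -EFinD; congr EFin.
have [w0|w0] := ltP w 0.
  have [[mu0 _ _ _] [mu'0 _ _ _]] := (hmu, hmu').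
  by rewrite !ccdf_lt0// !expr1n !mulr1 addrC subrK.
by rewrite mulr0 addr0 -tail// exprMn ad.
Qed.
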